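(* Let $n\ge 1$, let $k_1,\dots,k_n\ge 0$ be integers, and let $\mathcal{X}=S^{k_1}\vee\cdots\vee S^{k_n}$ be a wedge of spheres such that, if $\mathcal{X}$ has $m$ connected components, then $m-1$ of them are isolated points. Then there exists a permutation graph $G$ whose independence complex $I_G$ is homotopy equivalent to $\mathcal{X}$.
   Context: A chord diagram is a circle together with a finite set of chords with pairwise disjoint boundary points. It is a permutation chord diagram if the circle can be divided into two arcs $a_1$ and $a_2$ such that each chord connects a point of $a_1$ with a point of $a_2$. A permutation graph is the intersection graph of the chords of a permutation chord diagram: one vertex per chord, two vertices adjacent exactly when the chords intersect. The independence complex $I_G$ of a loopless graph $G$ is the simplicial complex whose simplices are the independent sets of vertices of $G$ (the empty set included); it is identified with its geometric realization. $S^0$ is the space of two isolated points. The wedge is formed by one-point identifications of base points; because $S^0$ is disconnected the wedge can be disconnected and can depend on the base points, and the hypothesis restricts to the case where all components except one are single points. *)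

(* Defs.v *)
From HB Require Import structures.
From mathcomp Require Import all_boot all_order all_algebra.
From mathcomp Require Import all_classical all_reals all_analysis.
From mathcomp Require Import homotopy.

Set Implicit Arguments.
Unset Strict Implicit.
Unset Printing Implicit Defensive.
Import Order.TTheory GRing.Theory Num.Theory.
Import numFieldNormedType.Exports.
Local Open Scope classical_set_scope.
Local Open Scope ring_scope.

Definition homeomorphic (X Y : topologicalType) : Prop :=
  exists (f : X -> Y) (g : Y -> X),
    [/\ continuous f, continuous g, cancel f g & cancel g f].

Definition homotopic (R : realType) (X Y : topologicalType) (f g : X -> Y) :
    Prop :=
  exists H : X * R -> Y,
    [/\ {within [set: X] `*` `[0, 1], continuous H},
        forall x, H (x, 0) = f x
      & forall x, H (x, 1) = g x].

Definition homotopy_equivalent (R : realType) (X Y : topologicalType) : Prop :=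
  exists (f : X -> Y) (g : Y -> X),
    [/\ continuous f, continuous g,
        homotopic R (g \o f) id & homotopic R (f \o g) id].

(* The norm of 'rV[R]_n is the sup norm, hence the explicit equation. *)
Definition unit_sphere (R : realType) (k : nat) : set 'rV[R]_k.+1 :=
  [set x | \sum_(i < k.+1) x 0 i ^+ 2 = 1].

Arguments unit_sphere : clear implicits.

Definition Sphere (R : realType) (k : nat) : topologicalType :=
  set_type (unit_sphere R k).

Definition wedge2 (X Y : topologicalType) (p : X) (q : Y) : topologicalType :=
  wedge (X := fun b : bool => if b then X else Y)
        (fun b : bool => if b return (if b then X else Y) then p else q).

(* Spaces built from spheres of the listed dimensions by successive wedges, for
   an arbitrary choice of the base points of every single wedge. When spheres
   S^0 occur, these choices affect the homotopy type of the result, and so they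
   are not required to form one common base point. *)
Inductive iterated_wedge (R : realType) : seq nat -> topologicalType -> Prop :=
| iterated_wedge_sphere (k : nat) : iterated_wedge R [:: k] (Sphere R k)
| iterated_wedge_wedge2 (s t : seq nat) (X Y : topologicalType)
    (p : X) (q : Y) :
    iterated_wedge R s X -> iterated_wedge R t Y ->
    iterated_wedge R (s ++ t) (wedge2 p q).

Definition wedge_of_spheres (R : realType) (s : seq nat) (X : topologicalType) :
    Prop :=
  exists2 W : topologicalType, iterated_wedge R s W & homeomorphic X W.

Definition components (X : topologicalType) : set (set X) :=
  connected_component [set: X] @` [set: X].

Arguments components : clear implicits.

Definition all_components_but_one_isolated_points (X : topologicalType) :
    Prop :=
  forall m : nat, (components X #= `I_m)%card ->
    exists D : set (set X),
      [/\ D `<=` components X, (D #= `I_m.-1)%card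
        & forall A, D A -> exists2 x, isolated [set: X] x & A = [set x]].

Record graph := Graph {
  vertex :> finType;
  adj : rel vertex;
  adj_sym : symmetric adj;
  adj_irr : irreflexive adj }.

Definition independent (G : graph) (A : {set G}) : bool :=
  [forall u in A, forall v in A, ~~ adj u v].

Definition independence_complex (G : graph) : {set {set G}} :=
  [set A : {set G} | independent A].

(* Points are given by their barycentric coordinates, indexed by the vertices. *)
Definition realization_set (R : realType) (V : finType) (K : {set {set V}}) :
    set (prod_topology (fun _ : V => R)) :=
  [set x | [/\ forall v, 0 <= x v, \sum_v x v = 1
             & [set v | x v != 0]%SET \in K]].

Definition realization (R : realType) (V : finType) (K : {set {set V}}) :
    topologicalType :=
  set_type (@realization_set R V K).

(* The circle is the unit circle of the plane and the chords, indexed by a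
   finite type, are straight segments, given by their two end points. *)
Record chord_diagram (R : realType) (C : finType) := ChordDiagram {
  chord_end : C -> bool -> 'rV[R]_2;
  chord_end_circle : forall c b, unit_sphere R 1 (chord_end c b);
  chord_end_inj : injective (fun cb : C * bool => chord_end cb.1 cb.2) }.

Definition chord (R : realType) (C : finType) (D : chord_diagram R C) (c : C) :
    set 'rV[R]_2 :=
  [set (1 - t) *: chord_end D c false + t *: chord_end D c true
    | t in `[0, 1]].

Definition circle_arc (R : realType) (s t : R) : set 'rV[R]_2 :=
  [set \row_(j < 2) (if j == 0 then cos u else sin u) | u in `[s, t]].

(* The two closed arcs share their end points; a chord end located there counts
   as lying on either arc. *)
Definition permutation_diagram (R : realType) (C : finType)
    (D : chord_diagram R C) : Prop :=
  exists s t : R, [/\ s < t, t < s + pi *+ 2 &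
    forall c : C, exists b : bool,
      circle_arc s t (chord_end D c b) /\
      circle_arc t (s + pi *+ 2) (chord_end D c (~~ b))].

Definition permutation_graph (R : realType) (G : graph) : Prop :=
  exists D : chord_diagram R G,
    permutation_diagram D /\
    forall u v : G, adj u v <-> u <> v /\ chord D u `&` chord D v !=set0.

(* Main.v *)
Require Import Defs.
From HB Require Import structures.
From mathcomp Require Import all_boot all_order all_algebra finmap.
From mathcomp Require Import all_classical all_reals all_analysis.
From mathcomp Require Import homotopy.
From mathcomp Require Import ring lra zify.

(** The graph. Start from the boundary of a cross-polytope, a sphere with
    [N + 1] pairs of opposite vertices; its first [k] pairs span a subsphere of
    dimension [k - 1]. Opposite vertices are adjacent, so that the sphere is
    the independence complex of disjoint edges. Add pairwise adjacent vertices,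
    each adjacent to all pairs but the first [k], for some [k] that depends on
    the vertex. Then the independence complex becomes a union of cones over
    these nested subspheres ([cone_graph]). One of the cones is on the whole
    sphere and makes it contractible. Every other cone, on a subsphere of
    dimension [k - 1], contributes a sphere of dimension [k]: its base also
    bounds a cone with the apex of the first one, and shrinking that cone to
    its apex leaves a wedge ([unfold_hequiv]). As an intersection graph the
    pairs are disjoint crosses in a row, and the other chords leave the row
    after [k] crosses ([cone_graph_permutation]).

    The wedge. By associativity an iterated wedge is obtained from a point by
    attaching one sphere at a time, at arbitrary points
    ([iterated_wedge_ind_attach]). The homotopy type of the result depends only
    on the homotopy type of the space and on the path component of the point to
    which the sphere is attached ([wedgeX_hequiv]): the wedges along a path
    form a family that deformation retracts to each of its members. Hence one
    can follow the attachments by adding cones to the complex ([attach_cone]),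
    as long as spheres of positive dimension are attached in the component of
    the first cone.

    The components. If all components but one are isolated points, then this
    also holds before the last sphere was attached, and a sphere of positive
    dimension was attached in the exceptional component, or to a discrete
    space, where all points are alike. This is what the induction carries along
    ([modelled]). *)

Set Implicit Arguments.
Unset Strict Implicit.
Unset Printing Implicit Defensive.
Import Order.TTheory GRing.Theory Num.Theory.
Import numFieldNormedType.Exports.
Local Open Scope classical_set_scope.
Local Open Scope ring_scope.

(** * Continuity of explicit formulas *)

Section Continuity.
Context {R : realType}.
Implicit Types X Y Z : topologicalType.

Lemma continuous_pair X Y Z (f : Z -> X) (g : Z -> Y) :
  continuous f -> continuous g -> continuous (fun z => (f z, g z)).
Proof. by move=> cf cg z; apply: cvg_pair; [exact: cf|exact: cg]. Qed.

Lemma continuous_after X Y Z (g : Y -> Z) (f : X -> Y) :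
  continuous g -> continuous f -> continuous (fun x => g (f x)).
Proof. by move=> cg cf x; apply: continuous_comp; [exact: cf|exact: cg]. Qed.

Lemma continuous_fst_of X Y Z (f : Z -> X * Y) :
  continuous f -> continuous (fun z => (f z).1).
Proof. by apply: continuous_after => x; exact: cvg_fst. Qed.

Lemma continuous_snd_of X Y Z (f : Z -> X * Y) :
  continuous f -> continuous (fun z => (f z).2).
Proof. by apply: continuous_after => x; exact: cvg_snd. Qed.

Lemma continuous_val_of X Z (A : set X) (f : Z -> set_type A) :
  continuous f -> continuous (fun z => \val (f z)).
Proof. by apply: continuous_after; exact: initial_continuous. Qed.

Lemma continuous_into_set X Z (A : set X) (f : Z -> set_type A) :
  continuous (fun z => \val (f z)) -> continuous f.
Proof.
move=> /continuousP cf; apply/continuousP => _ [B oB <-].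
exact: (cf B oB).
Qed.

Lemma continuous_into_prod (I : choiceType) Z
    (f : Z -> prod_topology (fun _ : I => R)) :
  (forall i, continuous (fun z => f z i)) -> continuous f.
Proof.
move=> cf z; apply/cvg_sup => i U [_ [[B oB <-] Bz BU]].
have: nbhs z ((fun z => f z i) @^-1` B) by apply: cf; exact: open_nbhs_nbhs.
by apply: filterS => y By; exact: BU.
Qed.

Lemma continuous_from_prod (I : choiceType) Z (i : I)
    (f : Z -> prod_topology (fun _ : I => R)) :
  continuous f -> continuous (fun z => f z i).
Proof.
move=> cf z; apply: (@continuous_comp _ _ _ f (@proj I (fun _ => R) i)).
  exact: cf.
exact: proj_continuous.
Qed.

Lemma continuous_into_row n Z (f : Z -> 'rV[R]_n) :
  (forall i, continuous (fun z => f z 0 i)) -> continuous f.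
Proof.
move=> cf z U [P nP PU].
have: \forall y \near z, forall i, P 0 i (f y 0 i).
  by apply: filter_forall => i; exact: cf (nP 0 i).
by apply: filterS => y Py; apply: PU => i j; rewrite ord1.
Qed.

Lemma continuous_from_row n Z (i : 'I_n) (f : Z -> 'rV[R]_n) :
  continuous f -> continuous (fun z => f z 0 i).
Proof.
move=> cf; apply: (@continuous_after _ _ _ (fun h : 'rV[R]_n => h 0 i)) => //.
exact: coord_continuous.
Qed.

(** Preimages of closed sets are unions of two closed sets. *)
Lemma pasting X Y (A B : set X) (f f1 f2 : X -> Y) :
  closed A -> closed B -> (forall x, A x \/ B x) ->
  (forall x, A x -> f x = f1 x) -> (forall x, B x -> f x = f2 x) ->
  continuous f1 -> continuous f2 -> continuous f.
Proof.
move=> cA cB AB fA fB /continuous_closedP c1 /continuous_closedP c2.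
apply/continuous_closedP => C cC.
rewrite (_ : _ @^-1` _ = (A `&` f1 @^-1` C) `|` (B `&` f2 @^-1` C)).
  by apply: closedU; apply: closedI => //; [exact: c1|exact: c2].
rewrite eqEsubset; split => x /=.
  by case: (AB x) => [Ax|Bx] Cx; [left; rewrite -fA|right; rewrite -fB].
by case=> -[h]; [rewrite fA|rewrite fB].
Qed.

(** Disjoint neighborhoods pull back along a map that separates the points. *)
Lemma hausdorff_separating X :
  (forall x y, x <> y -> exists (Z : topologicalType) (f : X -> Z),
     [/\ hausdorff_space Z, continuous f & f x <> f y]) -> hausdorff_space X.
Proof.
move=> sep x y xy; apply: contrapT => /sep[Z [f [hZ cf]]]; apply.
apply: hZ => U V /(cf x) nU /(cf y) nV.
by have [z [Uz Vz]] := xy (f @^-1` U) (f @^-1` V) nU nV; exists (f z).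
Qed.

Lemma closed_coincidence X Y (f g : X -> Y) : hausdorff_space Y ->
  continuous f -> continuous g -> closed [set x | f x = g x].
Proof.
move=> hY cf cg x clx; apply: hY => U V /(cf x) nU /(cg x) nV.
have nUV : nbhs x (f @^-1` U `&` g @^-1` V) by exact: filterI.
have [y [/= e [Uy Vy]]] := clx _ nUV.
by exists (f y); split => //; rewrite e.
Qed.

Lemma hausdorff_set X (A : set X) : hausdorff_space X ->
  hausdorff_space (set_type A).
Proof.
move=> hX; apply: hausdorff_separating => x y xy; exists X, (fun z => \val z).
split=> //; first exact: initial_continuous.
by move/val_inj.
Qed.

Lemma hausdorff_pair X Y : hausdorff_space X -> hausdorff_space Y ->
  hausdorff_space (X * Y)%type.
Proof.
move=> hX hY; apply: hausdorff_separating => -[x y] [x' y'] ne.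
have [e|e] := pselect (x = x').
  exists Y, (fun z => z.2); split=> //; first by move=> ?; exact: cvg_snd.
  by move=> /= e'; apply: ne; rewrite e e'.
by exists X, (fun z => z.1); split=> // ?; exact: cvg_fst.
Qed.

Lemma continuous_cst X Y (y : Y) : continuous (fun _ : X => y).
Proof. by move=> x; exact: cvg_cst. Qed.

Lemma continuous_id X : continuous (fun x : X => x).
Proof. by move=> x; exact: cvg_id. Qed.

Lemma continuousD_fun Z (f g : Z -> R) :
  continuous f -> continuous g -> continuous (fun z => f z + g z).
Proof. by move=> cf cg z; apply: cvgD; [exact: cf|exact: cg]. Qed.

Lemma continuousM_fun Z (f g : Z -> R) :
  continuous f -> continuous g -> continuous (fun z => f z * g z).
Proof. by move=> cf cg z; apply: cvgM; [exact: cf|exact: cg]. Qed.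

Lemma continuousN_fun Z (f : Z -> R) :
  continuous f -> continuous (fun z => - f z).
Proof. by move=> cf z; apply: cvgN; exact: cf. Qed.

Lemma continuous_norm_fun Z (f : Z -> R) :
  continuous f -> continuous (fun z => `|f z|).
Proof. by move=> cf z; apply: cvg_norm; exact: cf. Qed.

Lemma continuous_max_fun Z (f g : Z -> R) :
  continuous f -> continuous g -> continuous (fun z => Num.max (f z) (g z)).
Proof. by move=> cf cg z; exact: (continuous_max (cf z) (cg z)). Qed.

Lemma continuous_min_fun Z (f g : Z -> R) :
  continuous f -> continuous g -> continuous (fun z => Num.min (f z) (g z)).
Proof. by move=> cf cg z; exact: (continuous_min (cf z) (cg z)). Qed.

Lemma continuousX_fun Z (f : Z -> R) n :
  continuous f -> continuous (fun z => f z ^+ n).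
Proof.
move=> cf; apply: (@continuous_after _ R R (fun x => x ^+ n)) => //.
exact: exprn_continuous.
Qed.

Lemma continuousV_fun Z (f : Z -> R) : (forall z, f z != 0) ->
  continuous f -> continuous (fun z => (f z)^-1).
Proof. by move=> f0 cf z; apply: cvgV => //; exact: cf. Qed.

Lemma continuous_sum_fun Z (I : finType) (P : pred I) (f : I -> Z -> R) :
  (forall i, continuous (f i)) -> continuous (fun z => \sum_(i | P i) f i z).
Proof.
move=> cf; elim: (index_enum I) => [|i s IH].
  by under eq_fun do rewrite big_nil; exact: continuous_cst.
under eq_fun do rewrite big_cons; case: (P i) => //.
by apply: continuousD_fun => //; exact: cf.
Qed.

Lemma continuous_sqrt_fun Z (f : Z -> R) :
  continuous f -> continuous (fun z => Num.sqrt (f z)).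
Proof.
move=> cf; apply: (@continuous_after _ R R Num.sqrt) => //.
exact: sqrt_continuous.
Qed.

(** Makes a homotopy whose formula is valid on the unit interval only into one
    whose parameter runs over the whole line. *)
Definition clamp (u : R) : R := Num.max 0 (Num.min 1 u).

Lemma clamp01 u : 0 <= clamp u <= 1.
Proof. by rewrite /clamp le_max lexx /= ge_max ler01 ge_min lexx. Qed.

Lemma clamp0 : clamp 0 = 0.
Proof. by apply/max_idPl; rewrite ge_min lexx orbT. Qed.

Lemma clamp1 : clamp 1 = 1.
Proof. by rewrite /clamp minxx; apply/max_idPr. Qed.

Lemma continuous_clamp : continuous clamp.
Proof.
by apply: continuous_max_fun; [exact: continuous_cst|
  apply: continuous_min_fun; [exact: continuous_cst|exact: continuous_id]].
Qed.

Lemma continuous_ext X Y (f g : X -> Y) :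
  (forall x, f x = g x) -> continuous f -> continuous g.
Proof. by move=> /funext ->. Qed.

End Continuity.

(** Reduces the continuity of an explicit formula to hypotheses of the context.
    *)
Ltac continuity := repeat lazymatch goal with
 | H : continuous ?f |- continuous ?f => exact: H
 | H : continuous ?f |- continuous (fun z => ?f z) => exact: H
 | |- continuous (fun z => (@?f z, @?g z)) =>
     apply: (@continuous_pair _ _ _ f g)
 | |- continuous (fun z => @?f z + @?g z) =>
     apply: (@continuousD_fun _ _ f g)
 | |- continuous (fun z => @?f z * @?g z) =>
     apply: (@continuousM_fun _ _ f g)
 | |- continuous (fun z => - @?f z) =>
     apply: (@continuousN_fun _ _ f)
 | |- continuous (fun z => `|@?f z|) =>
     apply: (@continuous_norm_fun _ _ f)
 | |- continuous (fun z => Num.max (@?f z) (@?g z)) =>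
     apply: (@continuous_max_fun _ _ f g)
 | |- continuous (fun z => Num.min (@?f z) (@?g z)) =>
     apply: (@continuous_min_fun _ _ f g)
 | |- continuous (fun z => (@?f z) ^+ 2) =>
     apply: (@continuousX_fun _ _ f)
 | |- continuous (fun z => (@?f z).1) =>
     apply: (@continuous_fst_of _ _ _ f)
 | |- continuous (fun z => (@?f z).2) =>
     apply: (@continuous_snd_of _ _ _ f)
 | |- continuous (fun z => sval (@?f z)) =>
     apply: (@continuous_val_of _ _ _ f)
 | |- continuous (fun z => \sum_(i | _) (@?f i z)) =>
     apply: (@continuous_sum_fun _ _ _ _ f) => ?
 | |- continuous (fun z => z) => exact: continuous_id
 | |- continuous (fun z => fun_of_matrix (@?f z) _ ?i) =>
     apply: (@continuous_from_row _ _ _ i f)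
 | |- continuous fst => by move=> ?; exact: cvg_fst
 | |- continuous snd => by move=> ?; exact: cvg_snd
 | |- continuous sval => exact: initial_continuous
 | |- continuous (pair ?x) =>
     apply: (@continuous_pair _ _ _ (fun=> x) (fun z => z))
 | |- continuous id => exact: continuous_id
 | H : continuous ?h |- continuous (fun z => ?h (@?f z)) =>
     apply: (@continuous_after _ _ _ h f H)
 | |- continuous _ => exact: continuous_cst
end.

(** * Homotopies and paths *)

(** Homotopies are parametrized by the whole line, so that continuity never has
    to be relativized; restricting to the unit interval gives a homotopy in the
    usual sense. *)
Definition homotopic_line (R : realType) (X Y : topologicalType)
  (f g : X -> Y) : Prop :=
  exists H : X * R -> Y,
    [/\ continuous H, forall x, H (x, 0) = f x & forall x, H (x, 1) = g x].

Definition hequiv (R : realType) (X Y : topologicalType) (f : X -> Y) : Prop :=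
  continuous f /\
  exists g : Y -> X,
    [/\ continuous g, homotopic_line R (g \o f) id & homotopic_line R
      (f \o g) id].

Definition joined (R : realType) (X : topologicalType) (x y : X) : Prop :=
  exists g : R -> X, [/\ continuous g, g 0 = x & g 1 = y].

Section Homotopy.
Context {R : realType}.
Implicit Types W X Y Z : topologicalType.

Local Notation homotopic_line := (homotopic_line R).
Local Notation hequiv := (hequiv R).
Local Notation joined := (joined R).

Lemma eq_homotopic_line X Y (f g : X -> Y) : continuous f -> f =1 g ->
  homotopic_line f g.
Proof.
by move=> cf fg; exists (fun z => f z.1); split=> //; continuity.
Qed.

Lemma homotopic_line_sym X Y (f g : X -> Y) : homotopic_line f g ->
  homotopic_line g f.
Proof.
move=> [H [cH H0 H1]]; exists (fun z => H (z.1, 1 - z.2)); split=> [|x|x].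
- by continuity.
- by rewrite /= subr0.
- by rewrite /= subrr.
Qed.

Lemma concat_continuous X Y (f g : X * R -> Y) :
  continuous f -> continuous g -> (forall x, f (x, 1) = g (x, 0)) ->
  continuous (fun z : X * R =>
    if z.2 <= 2^-1 then f (z.1, 2 * z.2) else g (z.1, 2 * z.2 - 1)).
Proof.
move=> cf cg fg.
have /continuous_closedP cs : continuous (fun z : X * R => z.2) by continuity.
apply: (@pasting _ _ [set z : X * R | z.2 <= 2^-1] [set z | 2^-1 <= z.2] _
  (fun z => f (z.1, 2 * z.2)) (fun z => g (z.1, 2 * z.2 - 1))).
- exact: (cs [set t | t <= 2^-1] (@closed_le _ _)).
- exact: (cs [set t | 2^-1 <= t] (@closed_ge _ _)).
- by move=> z; case: (leP z.2 2^-1) => /= h; [left|right; exact: ltW].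
- by move=> z /= ->.
- move=> [x t] /= h; case: ifP => // h'.
  have -> : t = 2^-1 by apply/eqP; rewrite eq_le h h'.
  by rewrite mulfV ?pnatr_eq0// subrr fg.
- by continuity.
- by continuity.
Qed.

Lemma homotopic_line_trans X Y (f g h : X -> Y) : homotopic_line f g ->
  homotopic_line g h -> homotopic_line f h.
Proof.
move=> [F [cF F0 F1]] [G [cG G0 G1]].
exists (fun z : X * R =>
    if z.2 <= 2^-1 then F (z.1, 2 * z.2) else G (z.1, 2 * z.2 - 1)).
split=> [|x|x].
- by apply: concat_continuous => // x; rewrite F1 G0.
- by rewrite /= invr_ge0 ler0n mulr0.
- rewrite /= ifF; last by apply/negbTE; rewrite -ltNge invf_lt1 ?ltr1n.
  by rewrite mulr1 -[2]/(1 + 1) addrK.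
Qed.

Lemma homotopic_line_compl X Y Z (h : Y -> Z) (f g : X -> Y) :
  continuous h -> homotopic_line f g -> homotopic_line (h \o f) (h \o g).
Proof.
move=> ch [H [cH H0 H1]]; exists (fun z => h (H z)); split=> [|x|x].
- by continuity.
- by rewrite H0.
- by rewrite H1.
Qed.

Lemma homotopic_line_compr X Y Z (h : X -> Y) (f g : Y -> Z) :
  continuous h -> homotopic_line f g -> homotopic_line (f \o h) (g \o h).
Proof.
move=> ch [H [cH H0 H1]]; exists (fun z => H (h z.1, z.2)); split=> [|x|x].
- by continuity.
- by rewrite H0.
- by rewrite H1.
Qed.

Lemma hequiv_homeo X Y (f : X -> Y) (g : Y -> X) :
  continuous f -> continuous g -> cancel f g -> cancel g f -> hequiv f.
Proof.
move=> cf cg fg gf; split=> //; exists g; split=> //;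
  apply: eq_homotopic_line => //.
- by rewrite /comp; continuity.
- by rewrite /comp; continuity.
Qed.

Lemma hequiv_comp X Y Z (f : X -> Y) (g : Y -> Z) :
  hequiv f -> hequiv g -> hequiv (g \o f).
Proof.
move=> [cf [f' [cf' ff' f'f]]] [cg [g' [cg' gg' g'g]]].
split; first by rewrite /comp; continuity.
exists (f' \o g'); split; first by rewrite /comp; continuity.
- apply: homotopic_line_trans ff'.
  exact: (homotopic_line_compl cf' (homotopic_line_compr cf gg')).
- apply: homotopic_line_trans g'g.
  exact: (homotopic_line_compl cg (homotopic_line_compr cg' f'f)).
Qed.

(** A one-sided inverse of an equivalence is a two-sided inverse up to
    homotopy: with [g'] an inverse of [g], the chain
    [f \o g ~ g' \o (g \o f) \o g ~ g' \o g ~ id] gives the other side. *)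
Lemma hequiv_section X Y (f : X -> Y) (g : Y -> X) :
  continuous f -> hequiv g -> homotopic_line (g \o f) id -> hequiv f.
Proof.
move=> cf [cg [g' [cg' gg' g'g]]] gf; split=> //; exists g; split=> //.
apply: (homotopic_line_trans _ gg'); apply: homotopic_line_sym.
apply: (@homotopic_line_trans _ _ _ (g' \o (g \o f) \o g)).
  rewrite -[g' \o g]/(g' \o id \o g).
  apply: homotopic_line_compr => //; apply: homotopic_line_compl => //;
    exact: homotopic_line_sym.
rewrite -[X in homotopic_line _ X]/(id \o (f \o g)).
rewrite -[X in homotopic_line X _]/((g' \o g) \o (f \o g)).
by apply: homotopic_line_compr => //; rewrite /comp; continuity.
Qed.

(** If [k] inverts [g \o f] and [l] inverts [h \o g], then [g] has the right
    inverse [f \o k] and the left inverse [l \o h]; these are homotopic, and so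
    [k \o g] inverts [f]. *)
Lemma hequiv_two_of_six W X Y Z (f : W -> X) (g : X -> Y) (h : Y -> Z) :
  continuous f -> continuous g -> continuous h ->
  hequiv (g \o f) -> hequiv (h \o g) -> hequiv f.
Proof.
move=> cf cg ch [_ [k [ck kgf gfk]]] [_ [l [cl lhg hgl]]].
split=> //; exists (k \o g); split; [by rewrite /comp; continuity|exact: kgf|].
apply: (homotopic_line_trans _ lhg).
apply: (@homotopic_line_trans _ _ _ ((l \o (h \o g)) \o (f \o (k \o g)))).
  rewrite -[X in homotopic_line X _]/(id \o (f \o (k \o g))).
  apply: homotopic_line_compr; first by rewrite /comp; continuity.
  exact: homotopic_line_sym.
rewrite -[X in homotopic_line X _]/((l \o h) \o ((g \o f) \o k) \o g).
rewrite -[X in homotopic_line _ X]/((l \o h) \o id \o g).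
apply: homotopic_line_compr => //; apply: homotopic_line_compl => //.
by rewrite /comp; continuity.
Qed.

Lemma hequiv_homotopy_equivalent X Y (f : X -> Y) :
  hequiv f -> homotopy_equivalent R X Y.
Proof.
have w (Z Z' : topologicalType) (u v : Z -> Z') :
    homotopic_line u v -> homotopic R u v.
  move=> [H [cH H0 H1]]; exists H; split=> //.
  exact: continuous_subspaceT.
by move=> [cf [g [cg gf fg]]]; exists f, g; split=> //; exact: w.
Qed.

Lemma hequiv_inverse X Y (f : X -> Y) : hequiv f -> exists g : Y -> X, hequiv g.
Proof. by move=> [cf [g [cg gf fg]]]; exists g; split=> //; exists f. Qed.

Lemma joined_refl X (x : X) : joined x x.
Proof. by exists (fun=> x); split=> // t; exact: cvg_cst. Qed.

Lemma joined_sym X (x y : X) : joined x y -> joined y x.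
Proof.
move=> [g [cg g0 g1]]; exists (fun t => g (1 - t)); split.
- by continuity.
- by rewrite subr0.
- by rewrite subrr.
Qed.

Lemma joined_trans X (x y z : X) : joined x y -> joined y z -> joined x z.
Proof.
move=> [g [cg g0 g1]] [h [ch h0 h1]].
have cH : continuous (fun z : R * R =>
    if z.2 <= 2^-1 then g (2 * z.2) else h (2 * z.2 - 1)).
  apply: (@concat_continuous R X (fun z => g z.2) (fun z => h z.2)).
  - by continuity.
  - by continuity.
  - by move=> _ /=; rewrite g1 h0.
exists (fun t => if t <= 2^-1 then g (2 * t) else h (2 * t - 1)); split.
- apply: (@continuous_after _ _ _ _ (fun t : R => (t, t)) cH).
  by continuity.
- by rewrite invr_ge0 ler0n mulr0.
- rewrite ifF; last by apply/negbTE; rewrite -ltNge invf_lt1 ?ltr1n.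
  by rewrite mulr1 -[2]/(1 + 1) addrK.
Qed.

Lemma joined_image X Y (f : X -> Y) (x y : X) :
  continuous f -> joined x y -> joined (f x) (f y).
Proof.
move=> cf [g [cg g0 g1]]; exists (fun t => f (g t)); split.
- by continuity.
- by rewrite g0.
- by rewrite g1.
Qed.

Lemma homotopic_line_joined X Y (f g : X -> Y) x : homotopic_line f g ->
  joined (f x) (g x).
Proof.
move=> [H [cH H0 H1]]; exists (fun t => H (x, t)); split; rewrite ?H0 ?H1 //.
by continuity.
Qed.

End Homotopy.

(** * Wedges and the motion of their base points *)

Definition inset (X : topologicalType) (A : set X) (x : X) (Ax : A x) :
  set_type A := exist _ x (mem_set Ax).

Lemma inset_mem (X : topologicalType) (A : set X) (x : set_type A) : A (sval x).
Proof. by case: x => x /= /set_mem. Qed.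

(** The wedge as a subspace of the product, instead of a quotient of the sum:
    maps into it are pairs of maps, its first projection is a retraction onto
    the first summand, and a product with the line is again a subspace. *)
Definition wedge_set (X Y : topologicalType) (p : X) (q : Y) : set (X * Y) :=
  [set z | z.1 = p \/ z.2 = q].

Definition wedgeX (X Y : topologicalType) (p : X) (q : Y) : topologicalType :=
  set_type (wedge_set p q).

Definition winl (X Y : topologicalType) (p : X) (q : Y) (x : X) : wedgeX p q :=
  @inset _ (wedge_set p q) (x, q) (or_intror erefl).

Definition winr (X Y : topologicalType) (p : X) (q : Y) (y : Y) : wedgeX p q :=
  @inset _ (wedge_set p q) (p, y) (or_introl erefl).

(** A retraction of [S * R] onto the union of [S * {0}] and [{q} * R], for
    parameters of absolute value at most 1. The factor [c] says that [b (s, t)]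
    lies between [0] and [t], so that the retraction is a deformation
    retraction by straight lines in the second variable. *)
Definition well_pointed (R : realType) (S : topologicalType) (q : S) : Prop :=
  exists (a : S * R -> S) (b : S * R -> R),
  [/\ continuous a, continuous b,
      forall s, a (s, 0) = s /\ b (s, 0) = 0,
      forall t, `|t| <= 1 -> a (q, t) = q /\ b (q, t) = t
    & forall s t, `|t| <= 1 -> (b (s, t) = 0 \/ a (s, t) = q) /\
        exists2 c, 0 <= c <= 1 & b (s, t) = c * t].

Section Wedge.
Context {R : realType}.
Implicit Types A B S X Y Z : topologicalType.

Local Notation homotopic_line := (homotopic_line R).
Local Notation hequiv := (hequiv R).
Local Notation joined := (joined R).

Lemma inset_inj X (A : set X) (x y : set_type A) : sval x = sval y -> x = y.
Proof. by move/val_inj. Qed.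

Lemma winl_continuous X Y (p : X) (q : Y) : continuous (winl p q).
Proof. by apply: continuous_into_set => /=; continuity. Qed.

Lemma winr_continuous X Y (p : X) (q : Y) : continuous (winr p q).
Proof. by apply: continuous_into_set => /=; continuity. Qed.

Lemma wedgeXP X Y (p : X) (q : Y) (z : wedgeX p q) :
  (exists x, z = winl p q x) \/ (exists y, z = winr p q y).
Proof.
case: (inset_mem z) => e; [right; exists (sval z).2|left; exists (sval z).1];
  by apply: inset_inj; rewrite /=; case: (sval z) e => /= ? ? ->.
Qed.

Lemma hausdorff_wedgeX X Y (p : X) (q : Y) :
  hausdorff_space X -> hausdorff_space Y -> hausdorff_space (wedgeX p q).
Proof. by move=> hX hY; apply: hausdorff_set; exact: hausdorff_pair. Qed.

Section Slide.
Context (S B : topologicalType) (q : S) (g : R -> B).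
Hypotheses (qw : well_pointed R q) (hS : hausdorff_space S)
  (hB : hausdorff_space B) (cg : continuous g).

(** The wedges of [B] and [S] along all base points of a path [g], in one
    family over the unit interval. Each wedge of the family is a deformation
    retract of it, hence the homotopy type of the wedge does not change along
    the path. *)
Definition slide_set : set (B * R * S) :=
  [set z | 0 <= z.1.2 <= 1 /\ (z.2 = q \/ z.1.1 = g z.1.2)].

Definition slide_incl (b : B) (t : R) (h : b = g t) (t01 : 0 <= t <= 1)
    (z : wedgeX b q) : set_type slide_set.
Proof.
apply: (@inset _ _ ((sval z).1, t, (sval z).2)); split => //=.
by case: (inset_mem z) => [->|->]; [right|left].
Defined.

(** The retraction of a well pointed space, applied to the variables in [S] and
    in the interval, pushes the family to the union of [B * [0, 1]] and of the
    fiber over [t]; then the interval is shrunk to [t]. *)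
Lemma slide_incl_hequiv b t (h : b = g t) (t01 : 0 <= t <= 1) :
  hequiv (slide_incl h t01).
Proof.
have [al [be [cal cbe ab0 abq abt]]] := qw.
have cclamp := @continuous_clamp R.
pose ti (u : R) (z : B * R * S) :=
  t + (1 - clamp u) * (z.1.2 - t) + clamp u * be (z.2, z.1.2 - t).
have tin z : slide_set z -> `|z.1.2 - t| <= 1.
  by case=> /andP[z0 z1] _; case/andP: t01 => t0 t1; rewrite ler_norml; lra.
have tin01 u z : slide_set z -> 0 <= ti u z <= 1.
  move=> zE; have [_ [c /andP[c0 c1] bE]] := abt z.2 _ (tin _ zE).
  case: zE => /andP[z0 z1] _; case/andP: t01 => t0 t1.
  rewrite /ti bE; case/andP: (clamp01 u); move: (clamp u) => v v0 v1.
  have -> : t + (1 - v) * (z.1.2 - t) + v * (c * (z.1.2 - t)) =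
     t * (v * (1 - c)) + z.1.2 * (1 - v * (1 - c)) by ring.
  have vc0 : 0 <= v * (1 - c) by apply: mulr_ge0 => //; lra.
  have vc1 : v * (1 - c) <= 1 by rewrite -[leRHS]mulr1 ler_pM //; lra.
  move: (v * (1 - c)) vc0 vc1 => w w0 w1; nra.
(* [D2] deforms the part that lies over the path, [D] keeps the points of [B]
   fixed. The two formulas agree where the parts meet. *)
have D1P (z : set_type slide_set * R) :
  slide_set (g (ti z.2 (sval z.1)), ti z.2 (sval z.1),
             al ((sval z.1).2, clamp z.2 * ((sval z.1).1.2 - t))).
  split => /=; last by right.
  exact: tin01 (inset_mem _).
pose D2 (z : set_type slide_set * R) := inset (D1P z).
pose D (z : set_type slide_set * R) : set_type slide_set :=
  if pselect ((sval z.1).2 = q) then z.1 else D2 z.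
have DE z : (sval z.1).1.1 = g (sval z.1).1.2 -> D z = D2 z.
  rewrite /D; case: pselect => // e1 e2; apply: inset_inj.
  rewrite /= e1.
  have hz := tin _ (inset_mem z.1).
  have [_ bq] := abq _ hz.
  have hz' : `|clamp z.2 * ((sval z.1).1.2 - t)| <= 1.
    by case/andP: (clamp01 z.2) => c0 c1;
      rewrite normrM ger0_norm // -[leRHS]mulr1 ler_pM.
  have [aq _] := abq _ hz'.
  have tE : ti z.2 (sval z.1) = (sval z.1).1.2.
    by rewrite /ti e1 bq; ring.
  rewrite tE aq -e2 -e1.
  by case: (sval z.1) => -[].
have cti : continuous (fun z : set_type slide_set * R => ti z.2 (sval z.1)).
  by rewrite /ti; continuity.
have cD : continuous D.
  apply: (@pasting _ _ [set z : set_type slide_set * R | (sval z.1).2 = q]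
     [set z : set_type slide_set * R | (sval z.1).1.1 = g (sval z.1).1.2]
     _ fst D2).
  - by apply: closed_coincidence => //; continuity.
  - by apply: closed_coincidence => //; continuity.
  - by move=> z /=; have [_ []] := inset_mem z.1; [left|right].
  - by move=> z /= e; rewrite /D; case: pselect.
  - by move=> z /= /DE.
  - by continuity.
  - by apply: continuous_into_set => /=; continuity.
have D0 z : D (z, 0) = z.
  rewrite /D; case: pselect => //= zq; apply: inset_inj => /=.
  rewrite /ti clamp0 !mul0r (ab0 _).1 subr0 mul1r addr0 subrKC.
  case: z zq => -[[z1 z2] z3] h3 /= zq.
  by have [_ [//|/= ->]] := set_mem h3.
(* At the end of the deformation a point has arrived either in [B] or in the
   fiber over [t]. *)
have D1q z : (sval (D (z, 1))).2 = q \/ (sval (D (z, 1))).1.2 = t.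
  have [/= e|/= ne] := pselect ((sval z).2 = q).
    by left; rewrite /D; case: pselect.
  rewrite /D; case: pselect => //= _.
  rewrite /ti clamp1 subrr mul0r addr0 !mul1r.
  by have [[->|->] _] := abt (sval z).2 _ (tin _ (inset_mem z));
    [right; rewrite addr0|left].
have rhoP z : wedge_set b q ((sval (D (z, 1))).1.1, (sval (D (z, 1))).2).
  have [h' [/=|/=]] := inset_mem (D (z, 1)); first by right.
  by case: (D1q z) => -> //; [right|left; rewrite h].
pose rho z : wedgeX b q := inset (rhoP z).
have cD1 : continuous (fun z => D (z, 1)) by continuity.
have crho : continuous rho by apply: continuous_into_set => /=; continuity.
have cincl : continuous (slide_incl h t01)
  by apply: continuous_into_set => /=; continuity.
split=> //; exists rho; split=> //.
- apply: eq_homotopic_line => [|z].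
    by rewrite /comp; continuity.
  apply: inset_inj => /=.
  have D1E : D (slide_incl h t01 z, 1) = slide_incl h t01 z.
    rewrite /D; case: pselect => //= zq; apply: inset_inj => /=.
    rewrite /ti /= subrr !mulr0 (ab0 _).1 (ab0 _).2 mulr0 !addr0 -h.
    by case: (inset_mem z) => // ->.
  rewrite D1E /slide_incl /=; by case: (sval z).
- apply: (@homotopic_line_trans _ _ _ _ (fun z => D (z, 1))); last first.
    by apply: homotopic_line_sym; exists D.
  (* Now the interval can be shrunk to [t]. *)
  have QP (z : set_type slide_set * R) :
    slide_set ((sval (D (z.1, 1))).1.1,
       clamp z.2 * (sval (D (z.1, 1))).1.2 + (1 - clamp z.2) * t,
       (sval (D (z.1, 1))).2).
    have [h1 h2] := inset_mem (D (z.1, 1)).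
    split => /=.
      case/andP: h1 => h10 h11; case/andP: (t01) => t0 t1.
      by case/andP: (clamp01 z.2); move: (clamp z.2) => v v0 v1; nra.
    have [e|e] := D1q z.1; first by left.
    by rewrite e in h2 *; rewrite -mulrDl addrC subrK mul1r.
  exists (fun z => inset (QP z)); split.
  - apply: continuous_into_set => /=.
    have cD1' : continuous (fun z : set_type slide_set * R => D (z.1, 1))
      by continuity.
    by continuity.
  - move=> z; apply: inset_inj => /=.
    by rewrite clamp0 mul0r add0r subr0 mul1r.
  - move=> z; apply: inset_inj => /=.
    rewrite clamp1 mul1r subrr mul0r addr0.
    by case: (sval (D (z, 1))) => -[].
Qed.

End Slide.

Lemma wedgeX_map_subproof A B S (q : S) (e : A -> B) (p : A) (p' : B)
  (h : e p = p')
  (z : wedgeX p q) : wedge_set p' q (e (sval z).1, (sval z).2).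
Proof. by case: (inset_mem z) => [->|->]; [left|right]. Qed.

Definition wedgeX_map A B S (q : S) (e : A -> B) (p : A) (p' : B) (h : e p = p')
  (z : wedgeX p q) : wedgeX p' q := inset (wedgeX_map_subproof h z).

Lemma wedgeX_map_continuous A B S (q : S) (e : A -> B) (p : A) (p' : B)
  (h : e p = p') : continuous e -> continuous (@wedgeX_map A B S q e p p' h).
Proof. by move=> ce; apply: continuous_into_set => /=; continuity. Qed.

(** A homotopy from [h] to [k] moves the base point along a path. In the family
    of wedges over this path it connects the two induced maps, and the
    inclusions of both ends of the family are equivalences. *)
Lemma wedgeX_map_homotopic A B S (q : S) (h k : A -> B) (p : A) :
  well_pointed R q -> hausdorff_space S -> hausdorff_space B ->
  homotopic_line h k -> exists T : wedgeX (h p) q -> wedgeX (k p) q,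
    [/\ hequiv T, homotopic_line (T \o wedgeX_map (erefl (h p)))
      (wedgeX_map (erefl (k p)))
      & forall b, joined (T (winl _ _ b)) (winl _ _ b)].
Proof.
move=> qw hS hB [H [cH H0 H1]].
pose g t := H (p, t).
have cg : continuous g by rewrite /g; continuity.
have z01 : 0 <= (0 : R) <= 1 by rewrite lexx ler01.
have o01 : 0 <= (1 : R) <= 1 by rewrite lexx ler01.
have hi := slide_incl_hequiv qw hS hB cg (esym (H0 p)) z01.
have [ci1 [r [cr ri ir]]] := slide_incl_hequiv qw hS hB cg (esym (H1 p)) o01.
set i0 := slide_incl _ z01 in hi.
set i1 := slide_incl _ o01 in ci1 ri ir.
have ci0 : continuous i0 by case: hi.
have cclamp := @continuous_clamp R.
exists (r \o i0); split.
- apply: hequiv_comp => //; split=> //; exists i1; split=> //.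
- apply: (@homotopic_line_trans _ _ _ _
    (r \o (i1 \o wedgeX_map (erefl (k p))))); last first.
    rewrite -[X in homotopic_line _ X]/(id \o wedgeX_map (erefl (k p))).
    apply: (@homotopic_line_compr _ _ _ _ _ (r \o i1) id) => //.
    by apply: wedgeX_map_continuous;
      rewrite (_ : k = fun x => H (x, 1)) ?funeqE //; continuity.
  apply: (@homotopic_line_compl _ _ _ _ r (i0 \o wedgeX_map (erefl (h p)))) =>
    //.
  have EP (z : wedgeX p q * R) :
     slide_set q g (H ((sval z.1).1, clamp z.2), clamp z.2, (sval z.1).2).
    split=> /=; first exact: clamp01.
    by case: (inset_mem z.1) => [->|->]; [right|left].
  exists (fun z => inset (EP z)); split.
  - by apply: continuous_into_set => /=; continuity.
  - by move=> z; apply: inset_inj => /=; rewrite clamp0 H0.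
  - by move=> z; apply: inset_inj => /=; rewrite clamp1 H1.
- move=> b /=.
  apply: (@joined_trans _ _ _ (r (i1 (winl _ _ b)))); last first.
    exact: (homotopic_line_joined (winl _ _ b) ri).
  apply: joined_image => //.
  have EP (t : R) : slide_set q g (b, clamp t, q) by split;
    [exact: clamp01|left].
  exists (fun t => inset (EP t)); split.
  - by apply: continuous_into_set => /=; continuity.
  - by apply: inset_inj => /=; rewrite clamp0.
  - by apply: inset_inj => /=; rewrite clamp1.
Qed.

(** With [f] a homotopy inverse of [e], the maps induced by [f \o e] and
    [e \o f] are the identity up to the equivalences that move the base points.
    The base points of the three maps [e], [f], [e] do not close up, which is
    why two out of six is needed. *)
Lemma wedgeX_map_hequiv A B S (q : S) (e : A -> B) (p : A) :
  well_pointed R q -> hausdorff_space S -> hausdorff_space A ->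
  hausdorff_space B -> hequiv e -> hequiv (@wedgeX_map A B S q e p _ erefl).
Proof.
move=> qw hS hA hB [ce [f [cf fe ef]]].
have [T [hT Tfe _]] := wedgeX_map_homotopic p qw hS hA fe.
have [U [hU Uef _]] := wedgeX_map_homotopic (e p) qw hS hB ef.
have map_id (C : topologicalType) (x : C) : @wedgeX_map C C S q id x x erefl =
  id.
  by apply/funext => z; apply: inset_inj => /=; case: (sval z).
rewrite !map_id in Tfe Uef.
have cw := wedgeX_map_continuous.
apply: (@hequiv_two_of_six _ _ _ _ _ _
   (@wedgeX_map B A S q f (e p) _ erefl)
     (@wedgeX_map A B S q e (f (e p)) _ erefl)).
- exact: cw.
- exact: cw.
- exact: cw.
- rewrite (_ : _ \o _ = @wedgeX_map A A S q (f \o e) p _ erefl); last first.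
    by apply/funext => z; exact: inset_inj.
  by apply: (hequiv_section _ hT Tfe); apply: cw; rewrite /comp; continuity.
- rewrite (_ : _ \o _ = @wedgeX_map B B S q (e \o f) (e p) _ erefl); last first.
    by apply/funext => z; exact: inset_inj.
  by apply: (hequiv_section _ hU Uef); apply: cw; rewrite /comp; continuity.
Qed.

(** Up to equivalence a wedge depends only on the homotopy type of its first
    summand and on the path component of the base point in it. *)
Lemma wedgeX_hequiv A B S (q : S) (e : A -> B) (p : A) (p' : B) :
  well_pointed R q -> hausdorff_space S -> hausdorff_space A ->
  hausdorff_space B -> hequiv e -> joined (e p) p' ->
  exists F : wedgeX p q -> wedgeX p' q,
    hequiv F /\ forall a, joined (F (winl p q a)) (winl p' q (e a)).
Proof.
move=> qw hS hA hB he [g [cg g0 g1]].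
have hg : homotopic_line (fun _ : B => e p) (fun _ : B => p').
  by exists (fun z => g z.2); split=> //; continuity.
have [T [hT _ jT]] := @wedgeX_map_homotopic _ _ _ q _ _ p' qw hS hB hg.
exists (T \o @wedgeX_map A B S q e p _ erefl); split.
  apply: hequiv_comp => //; exact: wedgeX_map_hequiv.
move=> a /=.
rewrite (_ : wedgeX_map _ _ = winl _ _ (e a)) //.
exact: inset_inj.
Qed.

End Wedge.

(** * Iterated wedges as successive attachments of spheres *)

Section IteratedWedge.
Implicit Types X Y Z : topologicalType.

Lemma homeomorphic_sym X Y : homeomorphic X Y -> homeomorphic Y X.
Proof. by move=> [f [g [cf cg fg gf]]]; exists g, f. Qed.

Lemma hausdorff_homeo X Y : homeomorphic X Y -> hausdorff_space Y ->
  hausdorff_space X.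
Proof.
move=> [f [g [cf cg fg gf]]] hY; apply: hausdorff_separating => x y xy.
by exists Y, f; split=> // /(can_inj fg).
Qed.

(** Points are closed, so a map on the subspace of the product can be pasted
    from the two summands. *)
Lemma wedge2_homeo X Y (p : X) (q : Y) :
  hausdorff_space X -> hausdorff_space Y ->
    homeomorphic (wedge2 p q) (wedgeX p q).
Proof.
move=> hX hY.
pose XY (b : bool) : topologicalType := if b then X else Y.
pose pq (b : bool) : XY b := if b return XY b then p else q.
pose f (b : bool) : XY b -> wedgeX p q :=
  if b return XY b -> wedgeX p q then winl p q else winr p q.
have fpq i j : f i (pq i) = f j (pq j).
  by case: i j => -[]; apply: inset_inj.
pose F : wedge2 p q -> wedgeX p q := @wedge_fun _ XY pq _ f.
have FE b x : F (@wedge_lift bool XY pq b x) = f b x.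
  exact: wedge_lift_funE.
pose G (z : wedgeX p q) : wedge2 p q :=
  if pselect ((sval z).2 = q) then @wedge_lift bool XY pq true (sval z).1
  else @wedge_lift bool XY pq false (sval z).2.
have G2 z : (sval z).1 = p -> G z = @wedge_lift bool XY pq false (sval z).2.
  rewrite /G; case: pselect => //= e e'; rewrite e e'.
  exact: (@wedge_liftE bool XY pq false (pq false) true (pq true)).
exists F, G; split.
- by apply: wedge_fun_continuous => // -[] /=;
    [exact: winl_continuous|exact: winr_continuous].
- apply: (@pasting _ _ [set z : wedgeX p q | (sval z).2 =
    q] [set z : wedgeX p q | (sval z).1 = p] _
    (fun z => @wedge_lift bool XY pq true (sval z).1)
    (fun z => @wedge_lift bool XY pq false (sval z).2)).
  + by apply: closed_coincidence => //; continuity.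
  + by apply: closed_coincidence => //; continuity.
  + by move=> z; case: (inset_mem z); [right|left].
  + by move=> z /= e; rewrite /G; case: pselect.
  + by move=> z /= /G2.
  + by apply: (continuous_after (@wedge_lift_continuous bool XY pq true));
      continuity.
  + by apply: (continuous_after (@wedge_lift_continuous bool XY pq false));
      continuity.
- move=> z; have : [set: wedge2 p q] z by [].
  rewrite /wedge2 -(@wedgeTE bool XY pq) => -[[] _ [x _ <-]].
    rewrite FE /G /=; case: pselect => //=.
  by rewrite FE G2.
- move=> z; rewrite /G; case: pselect => /= h; rewrite FE; apply: inset_inj.
    by rewrite /= [RHS]surjective_pairing h.
  by rewrite /= [RHS]surjective_pairing; case: (inset_mem z) => // ->.
Qed.

Lemma wedgeX_homeo X X' Y Y' (f : X -> X') (f' : X' -> X) (g : Y -> Y')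
    (g' : Y' -> Y) (p : X) (q : Y) :
  continuous f -> continuous f' -> cancel f f' -> cancel f' f ->
  continuous g -> continuous g' -> cancel g g' -> cancel g' g ->
  homeomorphic (wedgeX p q) (wedgeX (f p) (g q)).
Proof.
move=> cf cf' ff' f'f cg cg' gg' g'g.
have P z : wedge_set p q z -> wedge_set (f p) (g q) (f z.1, g z.2).
  by case=> /= ->; [left|right].
have Q z : wedge_set (f p) (g q) z -> wedge_set p q (f' z.1, g' z.2).
  by case=> /= ->; [left; exact: ff'|right; exact: gg'].
exists (fun z => inset (P _ (inset_mem z))),
  (fun z => inset (Q _ (inset_mem z))).
split.
- by apply: continuous_into_set => /=; continuity.
- by apply: continuous_into_set => /=; continuity.
- by move=> z; apply: inset_inj; rewrite /= ff' gg'; case: (sval z).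
- by move=> z; apply: inset_inj; rewrite /= f'f g'g; case: (sval z).
Qed.

Lemma wedgeX_homeo_right X Y Y' (g : Y -> Y') (g' : Y' -> Y) (p : X) (q : Y) :
  continuous g -> continuous g' -> cancel g g' -> cancel g' g ->
  homeomorphic (wedgeX p q) (wedgeX p (g q)).
Proof.
move=> cg cg' gg' g'g.
by apply: (@wedgeX_homeo _ _ _ _ id id) => //; continuity.
Qed.

Lemma wedgeX_swap_subproof X Y (p : X) (q : Y) (z : wedgeX p q) :
  wedge_set q p ((sval z).2, (sval z).1).
Proof. by case: (inset_mem z) => /= ->; [right|left]. Qed.

Definition wedgeX_swap X Y (p : X) (q : Y) (z : wedgeX p q) : wedgeX q p :=
  inset (wedgeX_swap_subproof z).

Lemma wedgeX_swap_continuous X Y (p : X) (q : Y) :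
  continuous (@wedgeX_swap X Y p q).
Proof. by apply: continuous_into_set => /=; continuity. Qed.

Lemma wedgeX_swapK X Y (p : X) (q : Y) :
  cancel (@wedgeX_swap X Y p q) (@wedgeX_swap Y X q p).
Proof. by move=> z; apply: inset_inj; rewrite /=; case: (sval z). Qed.

(** Both sides are the triples in which at most one summand is left, read with
    two bracketings. *)
Lemma wedgeX_assoc X Y1 Y2 (p : X) (y a : Y1) (b : Y2) :
  homeomorphic (wedgeX p (winl a b y)) (wedgeX (winr p y a) b).
Proof.
pose Z := wedgeX p (winl a b y); pose Z' := wedgeX (winr p y a) b.
have P1 (z : Z) : wedge_set p y ((sval z).1, (sval (sval z).2).1).
  by case: (inset_mem z) => /= ->; [left|right].
have P2 (z : Z) : wedge_set (winr p y a) b (inset (P1 z), (sval (sval z).2).2).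
  case: (inset_mem (sval z).2) => /= e; last by right.
  case: (inset_mem z) => /= e'; last by right=> /=; rewrite e'.
  by left; apply: inset_inj; rewrite /= e e'.
have Q1 (z : Z') : wedge_set a b ((sval (sval z).1).2, (sval z).2).
  by case: (inset_mem z) => /= ->; [left|right].
have Q2 (z : Z') : wedge_set p (winl a b y) ((sval (sval z).1).1, inset (Q1 z)).
  case: (inset_mem (sval z).1) => /= e; first by left.
  case: (inset_mem z) => /= e'; first by left=> /=; rewrite e'.
  by right; apply: inset_inj; rewrite /= e e'.
exists (fun z => inset (P2 z)), (fun z => inset (Q2 z)); split.
- apply: continuous_into_set => /=; apply: continuous_pair; last by continuity.
  by apply: continuous_into_set => /=; continuity.
- apply: continuous_into_set => /=; apply: continuous_pair; first by continuity.
  by apply: continuous_into_set => /=; continuity.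
- move=> z; apply: inset_inj; rewrite /= [RHS]surjective_pairing.
  congr (_, _); apply: inset_inj; rewrite /=.
  by case: (sval (sval z).2).
- move=> z; apply: inset_inj; rewrite /= [RHS]surjective_pairing.
  congr (_, _); apply: inset_inj; rewrite /=.
  by case: (sval (sval z).1).
Qed.

Lemma iterated_wedge_hausdorff (R : realType) s Y :
  iterated_wedge R s Y -> hausdorff_space Y.
Proof.
elim=> [k|{}s t X {}Y p q _ hX _ hY].
  by apply: hausdorff_set; exact: norm_hausdorff.
by apply: wedge_hausdorff => -[].
Qed.

(** Wedging with an iterated wedge is a succession of wedges with one sphere.
    If the base point lies in the first half of the tree, this half is attached
    first and the other half is attached to the result, and symmetrically. *)
Lemma iterated_wedge_ind_attach (R : realType) (N : nat)
    (P : topologicalType -> Prop) :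
  (forall X Y, homeomorphic X Y -> P X -> P Y) ->
  (forall X (p : X) k (q : Sphere R k), (k <= N)%N -> P X -> P (wedgeX p q)) ->
  forall s Y, iterated_wedge R s Y -> all (fun k => (k <= N)%N) s ->
  forall X (p : X) (q : Y), P X -> P (wedgeX p q).
Proof.
move=> Ph Pa s Y; elim=> [k|{}s t Y1 Y2 a b w1 IH1 w2 IH2].
  by rewrite /= andbT => kN X p q; exact: Pa.
rewrite all_cat => /andP[sN tN] X p q PX.
have hY1 := iterated_wedge_hausdorff w1.
have hY2 := iterated_wedge_hausdorff w2.
have [f [f' [cf cf' ff' f'f]]] := wedge2_homeo a b hY1 hY2.
apply: (Ph _ _ (homeomorphic_sym (wedgeX_homeo_right p q cf cf' ff' f'f))).
have [[y ->]|[y ->]] := wedgeXP (f q).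
  apply: (Ph _ _ (homeomorphic_sym (wedgeX_assoc p y a b))).
  by apply: IH2 => //; exact: IH1.
apply: (Ph _ _ (homeomorphic_sym (wedgeX_homeo_right p (winr a b y)
  (@wedgeX_swap_continuous _ _ a b) (@wedgeX_swap_continuous _ _ b a)
  (@wedgeX_swapK _ _ a b) (@wedgeX_swapK _ _ b a)))).
rewrite (_ : wedgeX_swap _ = winl b a y); last exact: inset_inj.
apply: (Ph _ _ (homeomorphic_sym (wedgeX_assoc p y b a))).
by apply: IH1 => //; exact: IH2.
Qed.

End IteratedWedge.

(** * Round spheres *)

Section Spheres.
Context {R : realType}.

Local Notation joined := (joined R).

Definition dot n (x y : 'rV[R]_n) : R := \sum_i x 0 i * y 0 i.

Lemma dotC n (x y : 'rV[R]_n) : dot x y = dot y x.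
Proof. by apply: eq_bigr => i _; rewrite mulrC. Qed.

Lemma dotDl n (x y z : 'rV[R]_n) : dot (x + y) z = dot x z + dot y z.
Proof. by rewrite -big_split; apply: eq_bigr => i _; rewrite mxE mulrDl. Qed.

Lemma dotZl n a (x y : 'rV[R]_n) : dot (a *: x) y = a * dot x y.
Proof. by rewrite mulr_sumr; apply: eq_bigr => i _; rewrite mxE mulrA. Qed.

Lemma dotDr n (x y z : 'rV[R]_n) : dot z (x + y) = dot z x + dot z y.
Proof. by rewrite dotC dotDl !(dotC z). Qed.

Lemma dotZr n a (x y : 'rV[R]_n) : dot y (a *: x) = a * dot y x.
Proof. by rewrite dotC dotZl dotC. Qed.

Lemma dotNl n (x y : 'rV[R]_n) : dot (- x) y = - dot x y.
Proof. by rewrite -scaleN1r dotZl mulN1r. Qed.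

Lemma dotNr n (x y : 'rV[R]_n) : dot y (- x) = - dot y x.
Proof. by rewrite dotC dotNl dotC. Qed.

Lemma dot_ge0 n (x : 'rV[R]_n) : 0 <= dot x x.
Proof. by apply: sumr_ge0 => i _; rewrite -expr2 sqr_ge0. Qed.

Lemma dot_eq0 n (x : 'rV[R]_n) : (dot x x == 0) = (x == 0).
Proof.
apply/eqP/eqP => [x0|->]; last by rewrite /dot big1 // => i _;
  rewrite mxE mul0r.
apply/rowP => i; rewrite mxE; apply/eqP; rewrite -sqrf_eq0; apply/eqP.
apply: (psumr_eq0P (P := predT) (F := fun i => x 0 i ^+ 2)) => //.
by move=> j _; exact: sqr_ge0.
Qed.

Lemma dot_continuous n (Z : topologicalType) (f g : Z -> 'rV[R]_n) :
  (forall i, continuous (fun z => f z 0 i)) ->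
  (forall i, continuous (fun z => g z 0 i)) ->
  continuous (fun z => dot (f z) (g z)).
Proof.
by move=> cf cg; rewrite /dot; apply: continuous_sum_fun => i;
  apply: continuousM_fun.
Qed.

Lemma sphereE k (x : 'rV[R]_k.+1) : unit_sphere R k x <-> dot x x = 1.
Proof.
by split.
Qed.

Lemma dot_sphere k (s : Sphere R k) : dot (sval s) (sval s) = 1.
Proof. by have /sphereE := inset_mem s. Qed.

Lemma normalize_subproof k (x : 'rV[R]_k.+1) : x != 0 ->
  unit_sphere R k ((Num.sqrt (dot x x))^-1 *: x).
Proof.
rewrite -dot_eq0 => x0; apply/sphereE; rewrite dotZl dotZr mulrA -invfM -expr2.
by rewrite sqr_sqrtr ?dot_ge0 // mulVf.
Qed.

Definition normalize k (x : 'rV[R]_k.+1) (x0 : x != 0) : Sphere R k :=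
  inset (normalize_subproof x0).

Lemma normalize_continuous k (Z : topologicalType) (f : Z -> 'rV[R]_k.+1)
    (f0 : forall z, f z != 0) :
  (forall i, continuous (fun z => f z 0 i)) ->
  continuous (fun z => normalize (f0 z)).
Proof.
move=> cf; apply: continuous_into_set => /=; apply: continuous_into_row => i.
under eq_fun do rewrite mxE.
apply: continuousM_fun; last exact: cf.
apply: continuousV_fun => [z|].
  by rewrite sqrtr_eq0 -ltNge lt_def dot_ge0 dot_eq0 f0.
by apply: continuous_sqrt_fun; apply: dot_continuous.
Qed.

Lemma normalize_pos k (x : 'rV[R]_k.+1) (x0 : x != 0) (s : Sphere R k) (c : R) :
  0 < c -> x = c *: sval s -> normalize x0 = s.
Proof.
move=> c0 xE; apply: inset_inj => /=; rewrite xE dotZl dotZr dot_sphere mulr1.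
by rewrite -expr2 sqrtr_sqr gtr0_norm // scalerA mulVf ?scale1r // gt_eqF.
Qed.

Lemma normalize_id k (x : 'rV[R]_k.+1) (x0 : x != 0) (s : Sphere R k) :
  x = sval s -> normalize x0 = s.
Proof. by move=> e; apply: (@normalize_pos _ _ _ _ 1) => //;
  rewrite scale1r. Qed.

(** Soft thresholding: moves [x] towards [0] by [e]. Unlike a radial
    contraction it needs no division, so it is continuous in both variables at
    once. *)
Definition soft (x e : R) : R := Num.max (x - e) 0 - Num.max (- x - e) 0.

Lemma soft_ratio x e : 0 <= e -> exists2 c, 0 <= c <= 1 & soft x e = c * x.
Proof.
move=> e0; have [x0|x0|->] := ltgtP x 0.
- exists (soft x e / x); last by rewrite mulfVK // lt_eqF.
  rewrite ler_ndivlMr // ler_ndivrMr // mul0r mul1r /soft.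
  by case: (leP (x - e)); case: (leP (- x - e)); lra.
- exists (soft x e / x); last by rewrite mulfVK // gt_eqF.
  rewrite ler_pdivlMr // ler_pdivrMr // mul0r mul1r /soft.
  by case: (leP (x - e)); case: (leP (- x - e)); lra.
- by exists 0; rewrite ?lexx ?ler01 // /soft oppr0 subrr mul0r.
Qed.

Lemma soft_small x e : `|x| <= e -> soft x e = 0.
Proof.
rewrite ler_norml => /andP[h1 h2]; rewrite /soft.
by case: (leP (x - e)); case: (leP (- x - e)); lra.
Qed.

Lemma soft_close x e : 0 <= e -> `|soft x e - x| <= e.
Proof.
move=> e0; rewrite ler_norml /soft.
by case: (leP (x - e)); case: (leP (- x - e)); lra.
Qed.

Lemma soft0 x : soft x 0 = x.
Proof.
by rewrite /soft !subr0; case: (leP x); case: (leP (- x)); lra.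
Qed.

Lemma soft_neq0 x e : 0 <= e -> soft x e != 0 -> e < `|x|.
Proof.
by move=> e0; apply: contraNT; rewrite -leNgt => h; rewrite soft_small.
Qed.

(** Otherwise the squares of the coordinates would add up to less than 1. *)
Lemma sphere_large_coord k (s : Sphere R k) :
  exists i, (k.+2%:R)^-1 < `|sval s 0 i|.
Proof.
apply: contrapT => h.
have le i : `|sval s 0 i| <= (k.+2%:R)^-1.
  by rewrite leNgt; apply/negP => h'; apply: h; exists i.
have : dot (sval s) (sval s) <= \sum_(i < k.+1) (k.+2%:R)^-1 ^+ 2.
  apply: ler_sum => i _; rewrite -expr2 -real_normK ?num_real //.
  by rewrite ler_pXn2r ?nnegrE ?invr_ge0 ?ler0n.
rewrite dot_sphere sumr_const card_ord -[leRHS]mulr_natl expr2 mulrA.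
apply/negP; rewrite -ltNge.
have k2 : 0 < k.+2%:R :> R by rewrite ltr0n.
have : k.+1%:R / k.+2%:R < 1 :> R by rewrite ltr_pdivrMr // mul1r ltr_nat.
have : (k.+2%:R)^-1 < 1 :> R by rewrite invf_lt1 // ltr1n.
have : 0 < (k.+2%:R)^-1 :> R by rewrite invr_gt0.
by move: (_^-1) (_ / _) => a b; nra.
Qed.

(** Every coordinate of [s - q] is thresholded by a small multiple of the
    parameter and the result is projected back to the sphere. The multiple is
    smaller than some coordinate of [s], hence the projected vector is not
    zero. *)
Lemma sphere_well_pointed k (q : Sphere R k) : well_pointed R q.
Proof.
pose ep : R := (k.+2%:R)^-1.
have ep0 : 0 < ep by rewrite invr_gt0 ltr0n.
pose cl (t : R) : R := Num.min 1 `|t|.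
have cl01 t : 0 <= cl t <= 1 by rewrite le_min ler01 normr_ge0 ge_min lexx.
have clE t : `|t| <= 1 -> cl t = `|t| by move=> h; apply/min_idPr.
pose v (s : Sphere R k) i := sval s 0 i - sval q 0 i.
pose w (z : Sphere R k * R) : 'rV[R]_k.+1 :=
  \row_i (sval q 0 i + soft (v z.1 i) (ep * cl z.2)).
have w0 z : w z != 0.
  have [i hi] := sphere_large_coord z.1.
  apply/eqP => /rowP/(_ i); rewrite !mxE => e.
  have /andP[c0 c1] := cl01 z.2.
  have := @soft_close (v z.1 i) (ep * cl z.2) (mulr_ge0 (ltW ep0) c0).
  have -> : soft (v z.1 i) (ep * cl z.2) - v z.1 i = - sval z.1 0 i.
    by rewrite {2}/v; lra.
  rewrite normrN; apply/negP; rewrite -ltNge; apply: le_lt_trans hi.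
  by rewrite -[leRHS]mulr1 ler_pM2l.
(* [u s] is the time at which every coordinate has been thresholded away. *)
pose u s := (\sum_i `|v s i|) / ep.
have u0 s : 0 <= u s.
  by apply: divr_ge0 (ltW ep0); apply: sumr_ge0 => i _; exact: normr_ge0.
have vq i : v q i = 0 by rewrite /v subrr.
have uq : u q = 0 by rewrite /u big1 ?mul0r // => i _; rewrite vq normr0.
have csoft (Z : topologicalType) (f g : Z -> R) : continuous f ->
  continuous g ->
    continuous (fun z => soft (f z) (g z)).
  by move=> cf cg; rewrite /soft; continuity.
have cv i : continuous (fun z : Sphere R k * R => v z.1 i) by rewrite /v;
  continuity.
exists (fun z => normalize (w0 z)), (fun z => soft z.2 (u z.1)); split.
- apply: normalize_continuous => i.
  rewrite /w; under eq_fun do rewrite mxE.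
  apply: continuousD_fun; first by continuity.
  by apply: csoft; [exact: cv|rewrite /cl; continuity].
- by apply: csoft; [continuity|rewrite /u; apply: continuousM_fun; continuity;
    exact: cv].
- move=> s; split; last by rewrite soft_small // normr0.
  apply: normalize_id; apply/rowP => i; rewrite mxE /=.
  rewrite (_ : cl 0 = 0) ?mulr0 ?soft0 ?/v ?subrKC //.
  by rewrite /cl normr0; apply/min_idPr.
- move=> t ht; split; last by rewrite /= uq soft0.
  apply: normalize_id; apply/rowP => i; rewrite mxE /= vq soft_small ?addr0 //.
  by rewrite normr0; apply: mulr_ge0; [exact: ltW|case/andP: (cl01 t)].
- move=> s t ht; split; last exact: soft_ratio.
  have [->|/(soft_neq0 (u0 s)) ut] := eqVneq (soft t (u s)) 0; [by left|right].
  apply: normalize_id; apply/rowP => i; rewrite mxE /= soft_small ?addr0 //.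
  rewrite clE // -ler_pdivrMl // mulrC; apply/ltW/(le_lt_trans _ ut).
  rewrite ler_pM2r ?invr_gt0 // (bigD1 i) //= lerDl.
  by apply: sumr_ge0 => j _; exact: normr_ge0.
Qed.

Lemma hausdorff_sphere k : hausdorff_space (Sphere R k).
Proof. by apply: hausdorff_set; exact: norm_hausdorff. Qed.

Lemma sphere_segment_neq0 k (x y : Sphere R k) (t : R) : sval x != - sval y ->
  0 <= t <= 1 -> (1 - t) *: sval x + t *: sval y != 0.
Proof.
move=> xy /andP[t0 t1]; apply: contra xy => /eqP e.
have e' : (1 - t) *: sval x = - (t *: sval y) by apply/eqP; rewrite -addr_eq0 e.
have : dot ((1 - t) *: sval x) ((1 - t) *: sval x) =
  dot (t *: sval y) (t *: sval y).
  by rewrite e' dotNl dotNr opprK.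
rewrite !dotZl !dotZr !dot_sphere !mulr1 => tt.
have t2 : t = 2^-1 by nra.
move: e'; rewrite t2 (_ : 1 - 2^-1 = 2^-1 :> R); last by lra.
rewrite -scalerN => /(scalerI _) -> //.
Qed.

Lemma sphere_joined_nonantipodal k (x y : Sphere R k) :
  sval x != - sval y -> joined x y.
Proof.
move=> xy.
have cclamp := @continuous_clamp R.
have n0 u := sphere_segment_neq0 xy (clamp01 u).
exists (fun u => normalize (n0 u)); split.
- apply: normalize_continuous => i.
  apply: (continuous_ext (f := fun u =>
    (1 - clamp u) * sval x 0 i + clamp u * sval y 0 i)) => [u|].
    by rewrite !mxE.
  by continuity.
- apply: normalize_id.
  by rewrite clamp0 subr0 scale1r scale0r addr0.
- apply: normalize_id.
  by rewrite clamp1 subrr scale1r scale0r add0r.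
Qed.

Lemma delta_sphere k (i : 'I_k.+1) : unit_sphere R k (delta_mx 0 i).
Proof.
rewrite /unit_sphere /= (bigD1 i) //= big1 ?addr0 => [|j ji].
  by rewrite mxE !eqxx expr1n.
by rewrite mxE eqxx (negbTE ji) expr0n.
Qed.

(** Points that are not antipodal are joined by a projected segment; for
    antipodal points one of the first two vectors of the standard basis is a
    third point to pass through. *)
Lemma sphere_joined k (x y : Sphere R k) : (0 < k)%N -> joined x y.
Proof.
move=> k0.
have [e|] := eqVneq (sval x) (- sval y); last exact: sphere_joined_nonantipodal.
have two : exists r : Sphere R k, sval r != sval y /\ sval r != - sval y.
  pose d i : Sphere R k := inset (delta_sphere i).
  pose i1 : 'I_k.+1 := Ordinal (n := k.+1) (m := 1) k0.
  have h0 : sval (d ord0) 0 i1 = 0 by rewrite /= mxE.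
  have h1 : sval (d i1) 0 i1 = 1 by rewrite /= mxE !eqxx.
  have h00 : sval (d ord0) 0 ord0 = 1 by rewrite /= mxE !eqxx.
  apply: contrapT => no.
  have /orP[/eqP a0|/eqP a0] :
    (sval (d ord0) == sval y) || (sval (d ord0) == - sval y).
  - by rewrite -[_ || _]negbK negb_or; apply/negP => /andP[? ?]; apply: no;
      exists (d ord0).
  - have /orP[/eqP a1|/eqP a1] :
      (sval (d i1) == sval y) || (sval (d i1) == - sval y).
    + by rewrite -[_ || _]negbK negb_or; apply/negP => /andP[? ?]; apply: no;
        exists (d i1).
    + by move: h1; rewrite a1 -a0 h0 => /eqP; rewrite eq_sym oner_eq0.
    + move: h1; rewrite a1 mxE -a0 h0 => /eqP; rewrite oppr0 eq_sym oner_eq0 //.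
  - have /orP[/eqP a1|/eqP a1] :
      (sval (d i1) == sval y) || (sval (d i1) == - sval y).
    + by rewrite -[_ || _]negbK negb_or; apply/negP => /andP[? ?]; apply: no;
        exists (d i1).
    + move: h0; rewrite a0 mxE -a1 h1 => /eqP; rewrite oppr_eq0 oner_eq0 //.
    + by move: h1; rewrite a1 -a0 h0 => /eqP; rewrite eq_sym oner_eq0.
have [r [r1 r2]] := two.
apply: (@joined_trans _ _ _ r); apply: sphere_joined_nonantipodal => //.
by rewrite e eqr_opp eq_sym.
Qed.

(** The reflection in the hyperplane orthogonal to [v]; for [v = 0] the
    division by zero gives the identity, as it should. *)
Definition reflect_sphere k (v x : 'rV[R]_k.+1) : 'rV[R]_k.+1 :=
  x - (2 * dot x v / dot v v) *: v.

Lemma reflect_sphereK k (v : 'rV[R]_k.+1) : involutive (reflect_sphere v).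
Proof.
move=> x; rewrite /reflect_sphere.
have [v0|v0] := eqVneq (dot v v) 0.
  by rewrite v0 invr0 !mulr0 !scale0r !subr0.
rewrite dotDl dotNl dotZl.
have -> : 2 * (dot x v - 2 * dot x v / dot v v * dot v v) / dot v v =
   - (2 * dot x v / dot v v) by field.
by rewrite scaleNr opprK subrK.
Qed.

Lemma reflect_sphere_dot k (v x : 'rV[R]_k.+1) :
  dot (reflect_sphere v x) (reflect_sphere v x) = dot x x.
Proof.
rewrite /reflect_sphere.
have [v0|v0] := eqVneq (dot v v) 0.
  by rewrite v0 invr0 !mulr0 !scale0r !subr0.
rewrite !(dotDl, dotDr, dotNl, dotNr, dotZl, dotZr) (dotC v x).
by field.
Qed.

(** Two points of the sphere are exchanged by the reflection that their
    difference defines. *)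
Lemma sphere_homogeneous k (q n : Sphere R k) :
  exists f : Sphere R k -> Sphere R k,
    [/\ continuous f, involutive f & f q = n].
Proof.
pose v := sval q - sval n.
have P (s : Sphere R k) : unit_sphere R k (reflect_sphere v (sval s)).
  by apply/sphereE; rewrite reflect_sphere_dot dot_sphere.
exists (fun s => inset (P s)); split.
- apply: continuous_into_set => /=; apply: continuous_into_row => i.
  rewrite /reflect_sphere; under eq_fun do rewrite !mxE.
  apply: continuousD_fun; first by continuity.
  apply: continuousN_fun; apply: continuousM_fun; last by continuity.
  apply: continuousM_fun; last by continuity.
  apply: continuousM_fun; first by continuity.
  by apply: dot_continuous => j; continuity.
- by move=> s; apply: inset_inj => /=; rewrite reflect_sphereK.
- apply: inset_inj => /=; rewrite /reflect_sphere.
  have [v0|v0] := eqVneq (dot v v) 0.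
    rewrite v0 invr0 !mulr0 !scale0r !subr0.
    by apply/eqP; rewrite -subr_eq0 -dot_eq0 v0.
  have -> : 2 * dot (sval q) v / dot v v = 1.
    have -> : 2 * dot (sval q) v = dot v v; last by rewrite mulfV.
    rewrite /v !(dotDl, dotDr, dotNl, dotNr) !dot_sphere (dotC (sval n)).
    by ring.
  by rewrite scale1r /v opprB subrKC.
Qed.

End Spheres.

(** * Independence complexes made of cones over nested spheres *)

Section Realization.
Context {R : realType}.

Definition bary (V : finType) (K : {set {set V}}) (x : realization R K)
  (v : V) : R := sval x v.

Lemma continuous_bary (V : finType) (K : {set {set V}}) (Z : topologicalType)
    (v : V) (f : Z -> realization R K) :
  continuous f -> continuous (fun z => bary (f z) v).
Proof.
move=> cf.
exact: (@continuous_from_prod R V Z v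
  (fun z => sval (f z)) (continuous_val_of cf)).
Qed.

Lemma continuous_into_realization (V : finType) (K : {set {set V}})
    (Z : topologicalType) (f : Z -> realization R K) :
  (forall v, continuous (fun z => bary (f z) v)) -> continuous f.
Proof.
move=> cf; apply: (@continuous_into_set _ _ (@realization_set R V K)).
exact: continuous_into_prod.
Qed.

Lemma bary_inj (V : finType) (K : {set {set V}}) (x y : realization R K) :
  bary x =1 bary y -> x = y.
Proof. by move=> /funext e; apply: inset_inj. Qed.

Lemma hausdorff_realization (V : finType) (K : {set {set V}}) :
  hausdorff_space (realization R K).
Proof.
apply: hausdorff_set; apply: (@hausdorff_product V (fun _ => R)) => v.
exact: norm_hausdorff.
Qed.

Lemma independence_realizationP (G : graph) (x : G -> R) :
  realization_set (independence_complex G) x <->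
  [/\ forall v, 0 <= x v, \sum_v x v = 1
    & forall u v, adj u v -> x u = 0 \/ x v = 0].
Proof.
split=> -[x0 x1 h]; split=> //.
  move=> u v uv; have [|xu] := eqVneq (x u) 0; first by left.
  have [|xv] := eqVneq (x v) 0; first by right.
  move: h; rewrite inE => /forallP/(_ u)/implyP.
  rewrite inE => /(_ xu)/forallP/(_ v)/implyP; rewrite inE => /(_ xv).
  by rewrite uv.
rewrite inE; apply/forallP => u; apply/implyP; rewrite inE => xu.
apply/forallP => v; apply/implyP; rewrite inE => xv.
by apply/negP => /h[] /eqP; [rewrite (negbTE xu)|rewrite (negbTE xv)].
Qed.

Lemma bary_ge0 (G : graph) (x : realization R (independence_complex G)) v :
  0 <= bary x v.
Proof. by have /independence_realizationP[h _ _] := inset_mem x; exact: h. Qed.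

Lemma bary_sum (G : graph) (x : realization R (independence_complex G)) :
  \sum_v bary x v = 1.
Proof. by have /independence_realizationP[_ h _] := inset_mem x; exact: h. Qed.

Lemma bary_adj (G : graph) (x : realization R (independence_complex G)) u v :
  adj u v -> bary x u = 0 \/ bary x v = 0.
Proof. by have /independence_realizationP[_ _ h] := inset_mem x; exact: h. Qed.

Lemma bary_le1 (G : graph) (x : realization R (independence_complex G)) v :
  bary x v <= 1.
Proof.
rewrite -(bary_sum x) (bigD1 v) //= lerDl.
by apply: sumr_ge0 => *; exact: bary_ge0.
Qed.

Lemma delta_in (G : graph) (v0 : G) :
  realization_set (independence_complex G) (fun v => (v == v0)%:R : R).
Proof.
apply/independence_realizationP; split=> [v||u v uv].
- exact: ler0n.
- rewrite (bigD1 v0) //= eqxx big1 ?addr0 // => v /negbTE ->; by [].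
- have [eu|] := eqVneq u v0; last by left.
  have [ev|] := eqVneq v v0; last by right.
  by move: uv; rewrite eu ev adj_irr.
Qed.

Definition vertex_point (G : graph) (v0 : G) :
  realization R (independence_complex G) := inset (delta_in v0).

Lemma bary_continuous_id (G : graph) v :
  continuous (fun x : realization R (independence_complex G) => bary x v).
Proof. by apply: continuous_bary; continuity. Qed.

End Realization.

Ltac continuity_bary := repeat (lazymatch goal with
  | |- continuous (fun z => bary (@?f z) ?v) =>
      apply: (@continuous_bary _ _ _ _ v f)
  | |- _ => progress continuity
  end).

(** The pairs [(j, true)] and [(j, false)] span a cross-polytope, a sphere of
    dimension [N]; [T] indexes cones over subspheres of it. *)
Definition cone_vertex (N : nat) (T : finType) : finType :=
  (('I_N.+1 * bool) + T)%type.

(** The first [k] pairs of opposite vertices span a sphere of dimension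
    [k - 1]. A vertex [c] of [T] is independent of the first [d c] pairs and of
    nothing else, so that its link is this sphere. *)
Definition cone_adj (N : nat) (T : finType) (d : T -> nat)
  (u v : cone_vertex N T) : bool :=
  match u, v with
  | inl (i, a), inl (j, b) => (i == j) && (a != b)
  | inl (j, _), inr c | inr c, inl (j, _) => (d c <= j)%N
  | inr c, inr c' => c != c'
  end.

Lemma cone_adj_sym N (T : finType) (d : T -> nat) : symmetric (@cone_adj N T d).
Proof.
move=> [[i a]|c] [[j b]|c'] //=; first by rewrite eq_sym (eq_sym a).
by rewrite eq_sym.
Qed.

Lemma cone_adj_irr N (T : finType) (d : T -> nat) :
  irreflexive (@cone_adj N T d).
Proof. by move=> [[i a]|c] /=; rewrite !eqxx. Qed.

Definition cone_graph N (T : finType) (d : T -> nat) : graph :=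
  Graph (@cone_adj_sym N T d) (@cone_adj_irr N T d).

Definition option_dim (T : finType) (d : T -> nat) (k : nat) (c : option T) :
  nat := if c is Some t then d t else k.

Section AttachCone.
Context {R : realType} (N : nat) (T : finType) (d : T -> nat) (k : nat)
  (t0 : T).
Hypotheses (dt0 : d t0 = N.+1) (kN : (k <= N.+1)%N).

Local Notation K := (realization R (independence_complex (cone_graph N d))).
Local Notation K' := (realization R
  (independence_complex (cone_graph N (option_dim d k)))).
Local Notation V := (cone_vertex N T).
Local Notation V' := (cone_vertex N (option T)).
Local Notation pos r := (Num.max r 0).

Let lift (v : V) : V' :=
  match v with inl e => inl e | inr t => inr (Some t) end.
Let top : V' := inr None.
Let base : V := inr t0.
Local Notation base_point := (@vertex_point R (cone_graph N d) base).

Lemma sum_cone_vertex (f : V' -> R) :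
  \sum_v f v = f top + \sum_v f (lift v).
Proof.
rewrite !big_sumType /= [in LHS](bigD1 None) //= addrCA; congr (_ + (_ + _)).
rewrite (reindex_omap Some id) /=; last by case.
by apply: eq_bigl => t; rewrite eqxx.
Qed.

Lemma adj_lift u v :
  @adj (cone_graph N (option_dim d k)) (lift u) (lift v) =
    @adj (cone_graph N d) u v.
Proof. by case: u v => [[i a]|c] [[j b]|c']. Qed.

(** The cone with apex [t0] is the cone over the whole cross-polytope. *)
Lemma adj_base v : @adj (cone_graph N d) base v -> exists2 t, v =
  inr t & t != t0.
Proof.
case: v => [[j b]|t] /=; last by rewrite eq_sym => ne; exists t.
by rewrite dt0 leqNgt ltn_ord.
Qed.

(** The new cone, with apex [top], is cut where the apex has weight 1/2. On the
    lower half [lower] runs from 1 to 0, on the upper half [upper] runs from 0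
    to 1. *)
Let lower (x : K') : R := pos (1 - 2 * bary x top).
Let upper (x : K') : R := pos (2 * bary x top - 1).

Lemma top_adj (x : K') v : @adj (cone_graph N (option_dim d k)) top v ->
  bary x top != 0 -> bary x v = 0.
Proof. by move=> h; have [->|//] := bary_adj x h; rewrite eqxx. Qed.

(** The lower half of the new cone is laid on the cone with apex [t0], which
    has the same base: its bottom stays and its top goes to [t0]. *)
Definition low_fun (x : K') (v : V) : R :=
  lower x * bary x (lift v) + (v == base)%:R * (1 - lower x * (1 - bary x top)).

Lemma lower01 x : 0 <= lower x <= 1.
Proof.
have := bary_ge0 x top; rewrite /lower le_max lexx orbT ge_max ler01 andbT => h.
by lra.
Qed.

Lemma bary_sum_lift (x : K') : \sum_v bary x (lift v) = 1 - bary x top.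
Proof. by rewrite -(bary_sum x) sum_cone_vertex addrC addKr. Qed.

Lemma sum_delta_base (c : R) : \sum_v (v == base)%:R * c = c.
Proof.
rewrite (bigD1 base) //= eqxx mul1r big1 ?addr0 // => v /negbTE ->.
by rewrite mul0r.
Qed.

Lemma low_fun_base_free (x : K') v : bary x top = 0 -> low_fun x v =
  bary x (lift v).
Proof.
move=> x0; have l1 : lower x = 1.
  by rewrite /lower x0 mulr0 subr0; apply/max_idPl.
by rewrite /low_fun l1 x0 subr0 mulr1 subrr mulr0 mul1r addr0.
Qed.

Lemma low_fun_inr (x : K') t : bary x top != 0 -> t != t0 ->
  low_fun x (inr t) = 0.
Proof.
move=> x0 tt; rewrite /low_fun (_ : inr t == base = false).
  by rewrite mul0r addr0 (top_adj (v := inr (Some t))) ?mulr0.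
by apply/negbTE; apply: contra tt => /eqP [->].
Qed.

Lemma low_fun_in (x : K') :
  realization_set (independence_complex (cone_graph N d)) (low_fun x).
Proof.
have /andP[l0 l1] := lower01 x.
have x0 := bary_ge0 x top; have x1 := bary_le1 x top.
apply/independence_realizationP; split=> [v||u v uv].
- apply: addr_ge0; first by apply: mulr_ge0 => //; exact: bary_ge0.
  apply: mulr_ge0; first exact: ler0n.
  by rewrite subr_ge0 -[leRHS]mulr1 ler_pM //; lra.
- by rewrite big_split /= -mulr_sumr bary_sum_lift sum_delta_base subrKC.
- have [xt|xt] := eqVneq (bary x top) 0.
    rewrite !low_fun_base_free //; apply: bary_adj.
    by rewrite adj_lift.
  have [ub|ub] := eqVneq u base.
    by right; rewrite ub in uv; have [t -> tt] := adj_base uv;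
      exact: low_fun_inr.
  have [vb|vb] := eqVneq v base.
    left; rewrite vb adj_sym in uv; have [t -> tt] := adj_base uv.
    exact: low_fun_inr.
  rewrite /low_fun (negbTE ub) (negbTE vb) !mul0r !addr0.
  rewrite -adj_lift in uv.
  by have [->|->] := bary_adj x uv; rewrite mulr0; [left|right].
Qed.

Definition low (x : K') : K := inset (low_fun_in x).

Lemma low_continuous : continuous low.
Proof.
have cx v : continuous (fun x : K' => bary x v) by apply: continuous_bary;
  continuity.
apply: continuous_into_realization => v.
apply: (continuous_ext (f := fun x => low_fun x v)) => //.
by rewrite /low_fun /lower; continuity_bary.
Qed.

(** The upper half of the new cone is wrapped around the sphere: coordinate [0]
    is the height and rises from [-1] to [1], the others are the position in
    the base of the cone. *)
Definition high_vec (x : K') : 'rV[R]_k.+1 :=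
  \row_i (if i == 0 then 2 * upper x - 1 else
    upper x * (bary x (inl (inord i.-1, true)) - bary x
      (inl (inord i.-1, false)))).

Lemma top_edge (x : K') (j : 'I_N.+1) b : bary x top != 0 -> (k <= j)%N ->
  bary x (inl (j, b)) = 0.
Proof. by move=> x0 kj; apply: top_adj. Qed.

Lemma signed_bary (x : K') (j : 'I_N.+1) :
  `|bary x (inl (j, true)) - bary x (inl (j, false))| =
  bary x (inl (j, true)) + bary x (inl (j, false)).
Proof.
have jj : @adj (cone_graph N (option_dim d k)) (inl (j, true)) (inl (j, false)).
  by rewrite /= eqxx.
have [->|->] := bary_adj x jj.
- by rewrite sub0r normrN add0r ger0_norm // bary_ge0.
- by rewrite subr0 addr0 ger0_norm // bary_ge0.
Qed.

(** Off its base, a point of the new cone has at most one nonzero coordinate in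
    each pair of opposite vertices, and no coordinate outside of the cone. *)
Lemma edge_mass (x : K') : bary x top != 0 ->
  \sum_(j < N.+1 | (j < k)%N)
    `|bary x (inl (j, true)) - bary x (inl (j, false))| = 1 - bary x top.
Proof.
move=> x0; rewrite -bary_sum_lift big_sumType /=.
rewrite [X in _ = _ + X]big1 ?addr0 => [|t _]; last by apply: top_adj.
rewrite [RHS](eq_bigr (fun jb => bary x (inl (jb.1, jb.2)))); last by case.
rewrite -(pair_bigA _ (fun j b => bary x (inl (j, b)))) /=.
rewrite [RHS](bigID (fun j : 'I_N.+1 => (j < k)%N)) /= [X in _ =
  _ + X]big1 ?addr0.
  by apply: eq_bigr => j _; rewrite signed_bary big_bool.
by move=> j; rewrite -leqNgt => kj; rewrite big1 // => b _; exact: top_edge.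
Qed.

Lemma ltn_edge (i : 'I_k.+1) : i != 0 -> (i.-1 < N.+1)%N /\ (i.-1 < k)%N.
Proof.
move=> i0; have ipos : (0 < i)%N by rewrite lt0n; apply: contra i0.
have h : (i.-1 < k)%N by rewrite prednK // -ltnS; case: i {i0} ipos => -[].
by split=> //; exact: leq_trans h kN.
Qed.

(** Coordinate [i] of the sphere, for [i != 0], belongs to the pair of opposite
    vertices of index [i - 1]. *)
Lemma sum_edges (F : nat -> R) (f : 'I_k.+1 -> R) :
  (forall i : 'I_k.+1, i != 0 -> f i = F i.-1) ->
  \sum_i f i = f 0 + \sum_(j < N.+1 | (j < k)%N) F j.
Proof.
move=> fF; rewrite -(big_ord_widen N.+1 F kN) big_ord_recl; congr (_ + _).
by apply: eq_bigr => j _; rewrite fF.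
Qed.

(** At height [0], that is when the apex has weight 3/4, the base of the cone
    carries the remaining weight 1/4. *)
Lemma high_vec_neq0 x : high_vec x != 0.
Proof.
apply/eqP => /rowP e.
have := e 0; rewrite !mxE eqxx => h0.
have th2 : upper x = 2^-1 by lra.
have xt : bary x top = 3 / 4.
  by move: th2; rewrite /upper; case: leP; lra.
have x0 : bary x top != 0 by rewrite xt mulf_neq0 // invr_eq0.
have := edge_mass x0; rewrite big1 => [|j jk]; first by rewrite xt; lra.
have jk' : (j.+1 < k.+1)%N by [].
have := e (Ordinal jk'); rewrite !mxE /= th2 inord_val => /eqP.
by rewrite mulf_eq0 invr_eq0 pnatr_eq0 /= => /eqP ->; rewrite normr0.
Qed.

Lemma pole_in : unit_sphere R k (\row_i (if i == 0 then -1 else 0)).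
Proof.
rewrite /unit_sphere /= big_ord_recl big1 ?addr0 ?mxE ?eqxx ?sqrrN ?expr1n //.
by move=> i _; rewrite mxE /= expr0n.
Qed.

Definition pole : Sphere R k := inset pole_in.

Local Notation W := (wedgeX base_point pole).

Lemma high_pole x : 2 * bary x top <= 1 -> normalize (high_vec_neq0 x) = pole.
Proof.
move=> h; have th0 : upper x = 0 by rewrite /upper; apply/max_idPr; lra.
apply: normalize_id; apply/rowP => i; rewrite !mxE th0.
by case: eqP => _; rewrite ?mul0r // mulr0 sub0r.
Qed.

Lemma low_base x : 1 <= 2 * bary x top -> low x = base_point.
Proof.
move=> h; have l0 : lower x = 0 by rewrite /lower; apply/max_idPr; lra.
apply: bary_inj => v; rewrite /bary /= /low_fun l0 !mul0r add0r subr0 mulr1 //.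
Qed.

Lemma fold_in x : wedge_set base_point pole
  (low x, normalize (high_vec_neq0 x)).
Proof.
case: (lerP (2 * bary x top) 1) => h; [right; exact: high_pole|left].
exact/low_base/ltW.
Qed.

(** From the complex with the new cone to the wedge with a sphere: the lower
    half of the cone goes to the old complex, the upper half to the sphere.
    Where they meet both reach the base point of the wedge. *)
Definition fold (x : K') : W := inset (fold_in x).

Lemma high_vec_continuous i : continuous (fun x => high_vec x 0 i).
Proof.
have cx v := @bary_continuous_id R (cone_graph N (option_dim d k)) v.
case: (eqVneq i 0) => i0.
  apply: (continuous_ext (f := fun x => 2 * upper x - 1)) => [x|].
    by rewrite mxE i0 eqxx.
  by rewrite /upper; continuity_bary.
apply: (continuous_ext (f := fun x => upper x *
  (bary x (inl (inord i.-1, true)) - bary x (inl (inord i.-1, false))))) =>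
    [x|].
  by rewrite mxE (negbTE i0).
by rewrite /upper; continuity_bary.
Qed.

Lemma fold_continuous : continuous fold.
Proof.
apply: continuous_into_set => /=; apply: continuous_pair;
  first exact: low_continuous.
by apply: normalize_continuous => i; exact: high_vec_continuous.
Qed.

Definition signed (b : bool) (r : R) : R := pos (if b then r else - r).

(** The sphere as a subcomplex, before normalization of the barycentric
    coordinates: the suspension of the cross-polytope on the first [k] pairs,
    with the two apices [top] and [t0]. *)
Definition spread (w : 'rV[R]_k.+1) (v : V') : R :=
  match v with
  | inl (j, b) => if (j < k)%N then signed b (w 0 (inord j.+1)) else 0
  | inr (Some t) => if t == t0 then pos (- w 0 0) else 0
  | inr None => pos (w 0 0)
  end.

Definition l1norm (w : 'rV[R]_k.+1) : R := \sum_i `|w 0 i|.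

Lemma l1norm_gt0 w : w != 0 -> 0 < l1norm w.
Proof.
move=> w0; rewrite lt_def sumr_ge0 // andbT; apply: contra w0 => /eqP h.
apply/eqP/rowP => i; rewrite mxE; apply/eqP/normr0P.
by apply: (psumr_eq0P (P := predT) (F := fun i => `|w 0 i|)) => // j _;
  exact: normr_ge0.
Qed.

Lemma posZ c r : 0 <= c -> pos (c * r) = c * pos r :> R.
Proof. by move=> c0; rewrite maxr_pMr // mulr0. Qed.

Lemma pos_ge0 r : 0 <= pos r :> R.
Proof. by rewrite le_max lexx orbT. Qed.

Lemma pos_id r : 0 <= r -> pos r = r :> R.
Proof. by move=> r0; apply/max_idPl. Qed.

Lemma pos_eq0 r : r <= 0 -> pos r = 0 :> R.
Proof. by move=> r0; apply/max_idPr. Qed.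

Lemma pos_norm r : pos r + pos (- r) = `|r| :> R.
Proof.
by case: (ger0P r) => h; case: (leP r 0) => h1; case: (leP (- r) 0) => h2; lra.
Qed.

Lemma pos_or r : pos r = 0 \/ pos (- r) = 0 :> R.
Proof.
have [h|h] := leP r 0; [by left|right].
by apply/max_idPr; rewrite oppr_le0 ltW.
Qed.

Lemma spreadZ c w v : 0 <= c -> spread (c *: w) v = c * spread w v.
Proof.
move=> c0; case: v => [[j b]|[t|]] /=; rewrite ?mxE.
- case: ifP => _; last by rewrite mulr0.
  by rewrite /signed; case: b; rewrite -?mulrN posZ.
- by case: ifP => _; rewrite ?mulr0 // -mulrN posZ.
- by rewrite posZ.
Qed.

Lemma l1normZ c w : 0 <= c -> l1norm (c *: w) = c * l1norm w.
Proof.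
move=> c0; rewrite /l1norm mulr_sumr; apply: eq_bigr => i _.
by rewrite mxE normrM ger0_norm.
Qed.

Lemma spread_ge0 w v : 0 <= spread w v.
Proof.
by case: v => [[j b]|[t|]] /=; rewrite ?pos_ge0 //; case: ifP => // _;
  exact: pos_ge0.
Qed.

Lemma sum_edge_pairs (f : 'I_N.+1 * bool -> R) :
  \sum_e f e = \sum_j (f (j, true) + f (j, false)).
Proof.
rewrite (eq_bigr (fun jb => f (jb.1, jb.2))); last by case.
rewrite -(pair_bigA _ (fun j b => f (j, b))) /=.
by apply: eq_bigr => j _; rewrite big_bool.
Qed.

Lemma sum_spread w : \sum_v spread w v = l1norm w.
Proof.
rewrite sum_cone_vertex big_sumType sum_edge_pairs /=.
rewrite [X in _ + (_ + X)](bigD1 t0) //= eqxx.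
rewrite [X in _ + (_ + (_ + X))]big1 ?addr0 => [|t /negbTE -> //].
rewrite /l1norm (@sum_edges (fun i => `|w 0 (inord i.+1)|)); last first.
  move=> i i0; rewrite prednK ?inord_val // lt0n; exact: i0.
rewrite -(pos_norm (w 0 0)) addrCA addrC.
congr (_ + _); rewrite [RHS]big_mkcond; apply: eq_bigr => j _.
by case: ifP => _; rewrite ?addr0 // /signed pos_norm.
Qed.

Lemma spread_adj w u v : @adj (cone_graph N (option_dim d k)) u v ->
  spread w u = 0 \/ spread w v = 0.
Proof.
case: u v => [[i a]|[t|]] [[j b]|[t'|]] //=.
- move=> /andP[/eqP <-]; case: ifP => _; last by left.
  rewrite /signed; case: a b => -[] //= _; first exact: pos_or.
  by have [] := pos_or (w 0 (inord i.+1)); [right|left].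
- case: eqP => [->|]; last by right.
  by rewrite dt0 leqNgt ltn_ord.
- by rewrite leqNgt => /negbTE ->; left.
- case: eqP => [->|]; last by left.
  by rewrite dt0 leqNgt ltn_ord.
- have [->|_] := eqVneq t t0; last by left.
  by have [->|_] := eqVneq t' t0; [rewrite eqxx|right].
- by move=> _; case: eqP => _; [case: (pos_or (w 0 0)); [right|left]|left].
- by rewrite leqNgt => /negbTE ->; right.
- by move=> _; case: eqP => _; [exact: pos_or|right].
Qed.

Lemma sphere_neq0 (s : Sphere R k) : sval s != 0.
Proof. by rewrite -dot_eq0 dot_sphere oner_eq0. Qed.

Lemma spread_in w : w != 0 -> realization_set
  (independence_complex (cone_graph N (option_dim d k)))
  (fun v => spread w v / l1norm w).
Proof.
move=> w0; have l0 := l1norm_gt0 w0.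
apply/independence_realizationP; split=> [v||u v uv].
- by apply: divr_ge0; [exact: spread_ge0|exact: ltW].
- by rewrite -mulr_suml sum_spread mulfV // gt_eqF.
- by have [->|->] := spread_adj w uv; rewrite mul0r; [left|right].
Qed.

Lemma spread_normalize w (w0 : w != 0) v :
  spread (sval (normalize w0)) v / l1norm (sval (normalize w0)) =
  spread w v / l1norm w.
Proof.
have c0 : 0 < (Num.sqrt (dot w w))^-1.
  by rewrite invr_gt0 sqrtr_gt0 lt_def dot_eq0 w0 dot_ge0.
rewrite /= spreadZ ?l1normZ ?ltW // invfM mulrACA mulfV ?mul1r //.
by rewrite gt_eqF.
Qed.

Definition ext (a : V -> R) (v : V') : R :=
  match v with
  | inl e => a (inl e)
  | inr (Some t) => a (inr t)
  | inr None => 0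
  end.

Lemma ext_in (a : K) : realization_set
  (independence_complex (cone_graph N (option_dim d k))) (ext (bary a)).
Proof.
apply/independence_realizationP; split=> [v||u v uv].
- by case: v => [e|[t|]] //=; exact: (bary_ge0 a).
- rewrite (sum_cone_vertex (ext (bary a))) add0r -(bary_sum a).
  by apply: eq_bigr => -[e|t] _.
- have key u' v' : @adj (cone_graph N (option_dim d k)) (lift u') (lift v') ->
      bary a u' = 0 \/ bary a v' = 0.
    by rewrite adj_lift; exact: bary_adj.
  case: u v uv => [e|[t|]] [e'|[t'|]] uv; first [by left | by right | idtac].
  + exact: (key (inl e) (inl e') uv).
  + exact: (key (inl e) (inr t') uv).
  + exact: (key (inr t) (inl e') uv).
  + exact: (key (inr t) (inr t') uv).
Qed.

(** On the wedge one of the first two terms equals the third one, so that this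
    is the inclusion of the old complex on one summand and the inclusion of the
    suspension on the other. *)
Definition unfold_fun (z : K * Sphere R k) (v : V') : R :=
  ext (bary z.1) v + spread (sval z.2) v / l1norm (sval z.2) -
  (v == lift base)%:R.

Lemma spread_pole v :
  spread (sval pole) v / l1norm (sval pole) = (v == lift base)%:R.
Proof.
have -> : l1norm (sval pole) = 1.
  rewrite /l1norm big_ord_recl big1 ?addr0 => [|i _]; rewrite /= mxE /=.
    by rewrite normrN normr1.
  by rewrite normr0.
rewrite divr1; case: v => [[j b]|[t|]] /=; rewrite ?mxE ?eqxx.
- case: ifP => // jk; rewrite ?mxE (_ : inord _ == 0 = false); last first.
    by apply/negP => /eqP/(congr1 val); rewrite /= inordK.
  by rewrite /signed; case: b; rewrite ?oppr0 maxxx.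
- have -> : pos (- -1) = 1 :> R by rewrite opprK; apply/max_idPl; exact: ler01.
  case: eqP => [->|ne]; first by rewrite eqxx.
  by case: eqP => // -[] /ne.
- by apply/max_idPr; rewrite oppr_le0.
Qed.

Lemma unfold_winl (a : K) : unfold_fun (a, pole) = ext (bary a).
Proof. by apply/funext => v; rewrite /unfold_fun spread_pole addrK. Qed.

Lemma unfold_winr (s : Sphere R k) :
  unfold_fun (base_point, s) = fun v => spread (sval s) v / l1norm (sval s).
Proof.
apply/funext => v; rewrite /unfold_fun addrAC.
rewrite (_ : ext _ v = (v == lift base)%:R) ?subrr ?add0r //.
by case: v => [e|[t|]].
Qed.

Lemma unfold_in (z : W) : realization_set
  (independence_complex (cone_graph N (option_dim d k))) (unfold_fun (sval z)).
Proof.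
have [[a ->]|[s ->]] := wedgeXP z.
  by rewrite /= unfold_winl; exact: ext_in.
by rewrite /= unfold_winr; apply: spread_in; exact: sphere_neq0.
Qed.

Definition unfold (z : W) : K' := inset (unfold_in z).

Lemma l1norm_continuous (Z : topologicalType) (f : Z -> 'rV[R]_k.+1) :
  continuous f -> continuous (fun z => l1norm (f z)).
Proof. by move=> cf; rewrite /l1norm; continuity. Qed.

Lemma spread_continuous (Z : topologicalType) (f : Z -> 'rV[R]_k.+1) v :
  continuous f -> continuous (fun z => spread (f z) v).
Proof.
move=> cf; case: v => [[j b]|[t|]] /=; last by continuity.
  by case: (j < k)%N; rewrite /signed; [case: b|]; continuity.
by case: (t == t0); continuity.
Qed.

Lemma unfold_continuous : continuous unfold.
Proof.
apply: continuous_into_realization => v.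
apply: (continuous_ext (f := fun z : W => unfold_fun (sval z) v)) => //.
rewrite /unfold_fun.
apply: continuousD_fun; last by continuity.
apply: continuousD_fun.
  by case: v => [e|[t|]] /=; continuity_bary.
apply: continuousM_fun; first by apply: spread_continuous; continuity.
apply: continuousV_fun => [z|]; last by apply: l1norm_continuous; continuity.
by rewrite gt_eqF // l1norm_gt0 // sphere_neq0.
Qed.

(** On the new cone, [unfold \o fold] stays in the suspension with apices [t0]
    and [top] and moves the points along its meridians: from the base down to
    [t0], and from there all the way up to [top]. These are the coordinates of
    the straight homotopy to the identity, in which [height] is the position on
    the meridian, negative on the side of [t0]. *)
Let side_scale (x : K') (u : R) : R := (1 - u) * `|2 * bary x top - 1| + u.
Let height (x : K') (u : R) : R :=
  (1 - u) * (2 * upper x - (1 - lower x * (1 - bary x top))) + u * bary x top.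
Let meridian_mass (x : K') (u : R) : R :=
  side_scale x u * (1 - bary x top) + `|height x u|.

Lemma height_apex0 x u : bary x top = 0 -> height x u = 0.
Proof.
move=> x0; rewrite /height /upper /lower x0 !mulr0 !subr0 sub0r mulr1.
rewrite (@pos_eq0 (-1)) ?(@pos_id 1) ?oppr_le0 ?ler01 //.
by rewrite mulr0 subrr subrr mulr0 addr0.
Qed.

Lemma side_scale_ge0 x u : 0 <= u <= 1 -> 0 <= side_scale x u.
Proof.
move=> /andP[u0 u1]; apply: addr_ge0 => //.
by apply: mulr_ge0; [lra|exact: normr_ge0].
Qed.

Lemma meridian_mass_gt0 x u : 0 <= u <= 1 -> 0 < meridian_mass x u.
Proof.
move=> u01; have o0 := side_scale_ge0 x u01; have /andP[u0 u1] := u01.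
have x0 := bary_ge0 x top; have x1 := bary_le1 x top.
have m1 : 0 <= side_scale x u * (1 - bary x top) by apply: mulr_ge0 => //; lra.
rewrite lt_def addr_ge0 ?normr_ge0 // andbT /meridian_mass.
apply/negP; rewrite paddr_eq0 ?normr_ge0 // mulf_eq0 normr_eq0 subr_eq0.
move=> /andP[/orP[/eqP om0|/eqP top1] /eqP h0].
  have n0 := normr_ge0 (2 * bary x top - 1).
  have u00 : u = 0.
    have : 0 <= (1 - u) * `|2 * bary x top - 1| by apply: mulr_ge0 => //; lra.
    by move: om0; rewrite /side_scale; lra.
  move: om0; rewrite /side_scale u00 subr0 mul1r addr0 => /eqP;
    rewrite normr_eq0 => /eqP e.
  move: h0; rewrite /height u00 /upper /lower e.
  rewrite pos_id //.
  have -> : 1 - 2 * bary x top = 0 by lra.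
  by rewrite pos_id //; lra.
move: h0; rewrite /height /upper -top1.
rewrite pos_id; last by lra.
by rewrite subrr mulr0; lra.
Qed.

(** The old complex, where [top] has weight [0], does not move; only there can
    coordinates outside of the suspension be nonzero, and this is why one
    formula serves on the whole complex. *)
Definition meridian_fun (x : K') (u : R) (v : V') : R :=
  match v with
  | inl e => side_scale x u * bary x v
  | inr (Some t) => side_scale x u * bary x v + (t == t0)%:R * pos
    (- height x u)
  | inr None => pos (height x u)
  end / meridian_mass x u.

Lemma meridian_fun_apex0 x u v : 0 <= u <= 1 -> bary x top = 0 ->
  meridian_fun x u v = bary x v.
Proof.
move=> u01 x0; have m0 := meridian_mass_gt0 x u01; move: m0.
rewrite /meridian_fun /meridian_mass height_apex0 // x0 subr0 mulr1 normr0 addr0 => m0.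
have e0 : pos 0 = 0 :> R by exact: pos_id.
case: v => [e|[t|]]; rewrite ?oppr0 ?e0 ?mulr0 ?addr0 ?mul0r //.
- by rewrite mulrAC mulfV ?mul1r ?gt_eqF.
- by rewrite mulrAC mulfV ?mul1r ?gt_eqF.
Qed.

Lemma meridian_in x u : 0 <= u <= 1 -> realization_set
  (independence_complex (cone_graph N (option_dim d k))) (meridian_fun x u).
Proof.
move=> u01; have m0 := meridian_mass_gt0 x u01; have o0 := side_scale_ge0 x u01.
apply/independence_realizationP; split=> [v||v w vw].
- apply: divr_ge0; last exact: ltW.
  case: v => [e|[t|]]; rewrite ?pos_ge0 ?addr_ge0 ?mulr_ge0 ?pos_ge0
    ?bary_ge0 //.
- rewrite -mulr_suml (_ : \sum_v _ = meridian_mass x u) ?mulfV ?gt_eqF //.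
  rewrite (sum_cone_vertex (fun v => match v with
    | inl e => side_scale x u * bary x v
    | inr (Some t) => side_scale x u * bary x v + (t == t0)%:R * pos
      (- height x u)
    | inr None => pos (height x u) end)) /=.
  rewrite (eq_bigr (fun v => side_scale x u * bary x (lift v) +
     (v == base)%:R * pos (- height x u))); last first.
    by move=> [e|t] _ /=; rewrite ?mul0r ?addr0.
  rewrite big_split /= -mulr_sumr sum_delta_base bary_sum_lift.
  by rewrite addrCA pos_norm.
- have [xt|xt] := eqVneq (bary x top) 0.
    by rewrite !meridian_fun_apex0 //; exact: bary_adj.
  have st t : t != t0 -> meridian_fun x u (inr (Some t)) = 0.
    move=> tt; rewrite /meridian_fun (negbTE tt) mul0r addr0.
    by rewrite (top_adj (v := inr (Some t))) // mulr0 mul0r.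
  have se j b : bary x (inl (j, b)) = 0 -> meridian_fun x u (inl (j, b)) = 0.
    by rewrite /meridian_fun => ->; rewrite mulr0 mul0r.
  have half w1 w2 : meridian_fun x u w1 = 0 \/ meridian_fun x u w2 = 0 ->
      meridian_fun x u w2 = 0 \/ meridian_fun x u w1 = 0 by case; [right|left].
  have tt t t' : Some t != Some t' ->
      meridian_fun x u (inr (Some t)) = 0 \/ meridian_fun x u (inr (Some t')) =
        0.
    have [->|/st ->] := eqVneq t t0; last by left.
    by have [->|/st ->] := eqVneq t' t0; [rewrite eqxx|right].
  have jt (j : 'I_N.+1) b t : (d t <= j)%N ->
      meridian_fun x u (inl (j, b)) = 0 \/ meridian_fun x u (inr (Some t)) = 0.
    by have [->|/st ->] := eqVneq t t0; [rewrite dt0 leqNgt ltn_ord|right].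
  have tn t : meridian_fun x u (inr (Some t)) = 0 \/ meridian_fun x u top = 0.
    have [->|/st ->] := eqVneq t t0; last by left.
    rewrite /meridian_fun eqxx mul1r
      (top_adj (v := inr (Some t0))) // mulr0 add0r.
    by have [->|->] := pos_or (height x u); rewrite mul0r; [right|left].
  case: v w vw => [[i a]|[t|]] [[j b]|[t'|]] vw.
  + by have [/se ->|/se ->] := bary_adj x vw; [left|right].
  + exact: jt.
  + by left; apply: se; apply: top_edge.
  + by apply: half; exact: jt.
  + exact: tt.
  + exact: tn.
  + by right; apply: se; apply: top_edge.
  + by apply: half; exact: tn.
  + by [].
Qed.

(** The homotopy along the meridians starts at [unfold \o fold]; this is
    checked on the two halves of the new cone separately. *)
Lemma unfold_fold_homotopic : homotopic_line R (unfold \o fold) id.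
Proof.
pose H (z : K' * R) : K' := inset (meridian_in z.1 (clamp01 z.2)).
exists H; split.
- have cx v : continuous (fun z : K' * R => bary z.1 v) by continuity_bary.
  have cclamp := @continuous_clamp R.
  have com : continuous (fun z : K' * R => side_scale z.1 (clamp z.2))
    by rewrite /side_scale; continuity_bary.
  have cht : continuous (fun z : K' * R => height z.1 (clamp z.2)).
    by rewrite /height /upper /lower; continuity_bary.
  apply: continuous_into_realization => v.
  apply: (continuous_ext (f := fun z => meridian_fun z.1 (clamp z.2) v)) => //.
  rewrite /meridian_fun; apply: continuousM_fun; last first.
    apply: continuousV_fun => [z|]; last by rewrite /meridian_mass;
      continuity_bary.
    by rewrite gt_eqF // meridian_mass_gt0 // clamp01.
  by case: v => [e|[t|]]; continuity_bary.
- move=> x; apply: bary_inj => v; rewrite /bary /= clamp0.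
  rewrite /meridian_fun /meridian_mass /side_scale /height subr0 !mul1r
    !mul0r !addr0.
  have x0 := bary_ge0 x top; have x1 := bary_le1 x top.
  case: (leP (2 * bary x top) 1) => h.
    rewrite high_pole // unfold_winl.
    have t0' : upper x = 0 by apply: pos_eq0; lra.
    have lE : lower x = 1 - 2 * bary x top by apply: pos_id; lra.
    have -> : `|2 * bary x top - 1| = lower x by rewrite lE ler0_norm; lra.
    have [l0 l1] := andP (lower01 x).
    have hm : 0 <= 1 - lower x * (1 - bary x top).
      by rewrite subr_ge0 -[leRHS]mulr1 ler_pM //; lra.
    rewrite t0' mulr0 sub0r normrN ger0_norm // opprK.
    have -> : lower x * (1 - bary x top) + (1 - lower x * (1 - bary x top)) =
      1 by ring.
    rewrite divr1 (pos_id hm).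
    case: v => [e|[t|]] /=; rewrite /bary /= /low_fun /= ?mul0r ?addr0 //.
    by rewrite pos_eq0 // oppr_le0.
  have xt : bary x top != 0 by rewrite gt_eqF //; lra.
  rewrite low_base ?(ltW h) // unfold_winr spread_normalize.
  have lE : lower x = 0 by apply: pos_eq0; lra.
  have tE : upper x = 2 * bary x top - 1 by apply: pos_id; lra.
  have tp : 0 <= upper x by rewrite tE; lra.
  rewrite lE mul0r subr0 -tE ger0_norm //.
  have mE : l1norm (high_vec x) =
    upper x * (1 - bary x top) + `|2 * upper x - 1|.
    rewrite /l1norm (@sum_edges (fun j => upper x * `|
      bary x (inl (inord j, true)) - bary x (inl (inord j, false))|));
        last first.
      by move=> i i0; rewrite mxE (negbTE i0) normrM ger0_norm.
    rewrite mxE eqxx addrC -mulr_sumr -(edge_mass xt); congr (_ * _ + _).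
    by apply: eq_bigr => j _; rewrite inord_val.
  rewrite mE; congr (_ / _).
  case: v => [[j b]|[t|]] /=; rewrite ?mxE ?eqxx //.
  + case: ifP => jk; last first.
      by rewrite top_edge ?mulr0 // leqNgt jk.
    have j0 : inord j.+1 != 0 :> 'I_k.+1.
      by apply/negP => /eqP/(congr1 val); rewrite /= inordK.
    rewrite ?mxE (negbTE j0) inordK //= inord_val /signed.
    have jj : @adj (cone_graph N (option_dim d k)) (inl (j, true))
      (inl (j, false)).
      by rewrite /= eqxx.
    have c1 := bary_ge0 x (inl (j, true));
      have c2 := bary_ge0 x (inl (j, false)).
    have [e|e] := bary_adj x jj; case: b;
      rewrite e ?sub0r ?subr0 -?mulrN ?opprK posZ //;
      first [by rewrite pos_id | by rewrite pos_eq0 // oppr_le0].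
  + case: eqP => [->|/eqP tt]; rewrite
      (top_adj (v := inr (Some _))) // mulr0 add0r.
      by rewrite mul1r.
    by rewrite mul0r.
- move=> x; apply: bary_inj => v; rewrite /bary /= clamp1.
  rewrite /meridian_fun /meridian_mass /side_scale /height subrr !mul0r
    !add0r !mul1r.
  rewrite ger0_norm ?bary_ge0 // subrK divr1.
  rewrite pos_eq0 ?oppr_le0 ?bary_ge0 //.
  case: v => [e|[t|]]; rewrite ?mul1r ?mulr0 ?addr0 //.
  by rewrite pos_id // bary_ge0.
Qed.

Lemma unfold_top_winl (a : K) : bary (unfold (winl base_point pole a)) top = 0.
Proof. by rewrite /bary /= unfold_winl. Qed.

Lemma low_winl (a : K) v : low_fun (unfold (winl base_point pole a)) v =
  bary a v.
Proof.
rewrite low_fun_base_free ?unfold_top_winl // {1}/bary /= unfold_winl.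
by case: v.
Qed.

Lemma bary_unfold_winr (s : Sphere R k) v :
  bary (unfold (winr base_point pole s)) v =
    spread (sval s) v / l1norm (sval s).
Proof. by rewrite /bary /= unfold_winr. Qed.

Lemma low_winr_inr s t : t != t0 ->
  low_fun (unfold (winr base_point pole s)) (inr t) = 0.
Proof.
move=> tt; rewrite /low_fun bary_unfold_winr /= (negbTE tt) mul0r mulr0 add0r.
rewrite (_ : inr t == base = false) ?mul0r //.
by apply/negbTE; apply: contra tt => /eqP [->].
Qed.

(** First stage of the homotopy from [fold \o unfold] to the identity: on the
    sphere the component in the old complex leaves [t0], reaches the base of
    the cone with this apex at the equator, and returns; it is contracted to
    [t0] inside of this cone. *)
Lemma pull_in (z : W) u : 0 <= u <= 1 -> realization_set
  (independence_complex (cone_graph N d))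
  (fun v => (1 - u) * low_fun (unfold z) v + u * bary (sval z).1 v).
Proof.
move=> /andP[u0 u1]; have [[a ->]|[s ->]] := wedgeXP z.
  rewrite (_ : (fun _ => _) = bary a); first exact: (inset_mem a).
  by apply/funext => v; rewrite low_winl -mulrDl subrK mul1r.
have := low_fun_in (unfold (winr base_point pole s)).
move=> /independence_realizationP[l0 l1 la].
apply/independence_realizationP; split=> [v||v w vw].
- by apply: addr_ge0; apply: mulr_ge0 => //; rewrite ?subr_ge0 // bary_ge0.
- by rewrite big_split /= -!mulr_sumr l1 (bary_sum base_point) !mulr1 subrK.
- have key t : t != t0 -> (1 - u) * low_fun (unfold (winr base_point pole s))
    (inr t) +
      u * bary (base_point : K) (inr t) = 0.
    move=> tt; rewrite low_winr_inr // mulr0 add0r /bary /=.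
    by rewrite (_ : inr t == base = false) ?mulr0 //; apply/negbTE;
      apply: contra tt => /eqP [->].
  have [vb|vb] := eqVneq v base.
    by right; rewrite vb in vw; have [t -> /key] := adj_base vw.
  have [wb|wb] := eqVneq w base.
    by left; rewrite wb adj_sym in vw; have [t -> /key] := adj_base vw.
  have db v' : v' != base -> u * bary (base_point : K) v' = 0.
    by rewrite /bary /= => /negbTE ->; rewrite mulr0.
  by have [e|e] := la _ _ vw; [left|right]; rewrite e mulr0 add0r db.
Qed.

Definition pull (z : W) u (u01 : 0 <= u <= 1) : K := inset (pull_in z u01).

Lemma pull_fold_in (z : W) u (u01 : 0 <= u <= 1) :
  wedge_set base_point pole (pull z u01, normalize (high_vec_neq0 (unfold z))).
Proof.
have [[a ->]|[s ->]] := wedgeXP z.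
  right; rewrite /= high_pole // unfold_top_winl mulr0; exact: ler01.
have [h|h] := leP (2 * bary (unfold (winr base_point pole s)) top) 1.
  by right; exact: high_pole.
left; apply: bary_inj => v; rewrite {1}/bary /=.
have := low_base (ltW h) => /(congr1 (fun x => bary x v)).
by rewrite {1}/bary /= => ->; rewrite -mulrDl subrK mul1r.
Qed.

Lemma high_vec_unfold_winr s i : i != 0 ->
  high_vec (unfold (winr base_point pole s)) 0 i =
  upper (unfold (winr base_point pole s)) / l1norm (sval s) * sval s 0 i.
Proof.
move=> i0; have [i1 i2] := ltn_edge i0.
rewrite mxE (negbTE i0) !bary_unfold_winr /= inordK // i2 -mulrBl.
rewrite prednK ?lt0n // inord_val /signed.
have -> (r : R) : pos r - pos (- r) = r by case: (leP r 0);
  case: (leP (- r) 0); lra.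
by rewrite mulrAC mulrA.
Qed.

(** Second stage: on the sphere what is left is the map that wraps the upper
    hemisphere around. It is nowhere antipodal to the identity, because all
    coordinates but the height are scaled by a nonnegative factor and the poles
    are fixed. *)
Lemma push_neq0 (z : W) u : 0 <= u <= 1 ->
  (1 - u) *: high_vec (unfold z) + u *: sval (sval z).2 != 0.
Proof.
move=> /andP[u0 u1]; have [[a ->]|[s ->]] := wedgeXP z.
  rewrite (_ : high_vec _ = sval pole); last first.
    apply/rowP => i; rewrite !mxE /upper unfold_top_winl mulr0 sub0r.
    by rewrite (@pos_eq0 (-1)) ?oppr_le0 // mulr0 mul0r sub0r.
  by rewrite -scalerDl subrK scale1r sphere_neq0.
have [->|un] := eqVneq u 0.
  by rewrite subr0 scale1r scale0r addr0 high_vec_neq0.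
have up : 0 < u by rewrite lt_def un.
apply/eqP => /rowP e.
have n0 := l1norm_gt0 (sphere_neq0 s).
have t0' := pos_ge0 (2 * bary (unfold (winr base_point pole s)) top - 1).
have si i : i != 0 -> sval s 0 i = 0.
  move=> i0; have := e i; rewrite !mxE -/(high_vec _ 0 i).
  have := high_vec_unfold_winr s i0; rewrite mxE => ->.
  rewrite /= mulrA -mulrDl => /eqP; rewrite mulf_eq0 gt_eqF //=; first
    by move/eqP.
  apply: ltr_wpDl => //; apply: mulr_ge0; first by rewrite subr_ge0.
  by apply: divr_ge0 => //; exact: ltW.
have nE : l1norm (sval s) = `|sval s 0 0|.
  rewrite /l1norm (bigD1 0) //= big1 ?addr0 // => i i0.
  by rewrite si // normr0.
have s1 : `|sval s 0 0| = 1.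
  have := dot_sphere s; rewrite /dot (bigD1 0) //= big1 ?addr0 => [|i i0];
    last first.
    by rewrite si // mul0r.
  rewrite -expr2 -real_normK ?num_real // => /eqP; rewrite sqrp_eq1 //.
  by move/eqP.
have := e 0; rewrite !mxE eqxx /upper bary_unfold_winr /= nE s1 divr1.
have [h|h] := leP (sval s 0 0) 0.
  rewrite ler0_norm // in s1.
  rewrite mulr0 sub0r (@pos_eq0 (-1)) ?oppr_le0 // mulr0 sub0r.
  have -> : sval s 0 0 = -1 by lra.
  lra.
rewrite gtr0_norm // in s1.
rewrite s1 mulr1 pos_id; lra.
Qed.

Lemma push_in (z : W) u (u01 : 0 <= u <= 1) :
  wedge_set base_point pole ((sval z).1, normalize (push_neq0 z u01)).
Proof.
have [[a ->]|[s ->]] := wedgeXP z; last by left.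
right; apply: normalize_id => /=.
rewrite (_ : high_vec _ = sval pole); last first.
  apply/rowP => i; rewrite !mxE /upper unfold_top_winl mulr0 sub0r.
  by rewrite (@pos_eq0 (-1)) ?oppr_le0 // mulr0 mul0r sub0r.
by rewrite -scalerDl subrK scale1r.
Qed.

Lemma fold_unfold_homotopic : homotopic_line R (fold \o unfold) id.
Proof.
have cclamp := @continuous_clamp R.
have cu := unfold_continuous.
have cx v : continuous (fun x : K' => bary x v) by continuity_bary.
apply: (@homotopic_line_trans _ _ _ _
  (fun z : W => inset (push_in z (clamp01 0)))).
  exists (fun z : W * R => inset (pull_fold_in z.1 (clamp01 z.2))); split.
  - apply: continuous_into_set => /=; apply: continuous_pair.
      apply: continuous_into_realization => v.
      apply: (continuous_ext (f := fun z : W * R => (1 - clamp z.2) *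
         low_fun (unfold z.1) v + clamp z.2 * bary (sval z.1).1 v)) => //.
      by rewrite /low_fun /lower; continuity_bary.
    apply: normalize_continuous => i.
    apply: (continuous_after (@high_vec_continuous i)).
    by continuity_bary.
  - move=> z; apply: inset_inj => /=; congr (_, _).
    apply: bary_inj => v; rewrite /bary /= clamp0.
    by rewrite subr0 mul1r mul0r addr0.
  - move=> z; apply: inset_inj => /=; congr (_, _).
      apply: bary_inj => v; rewrite {1}/bary /= clamp1.
      by rewrite subrr mul0r add0r mul1r.
    apply: inset_inj => /=.
    by rewrite clamp0 subr0 scale1r scale0r addr0.
exists (fun z : W * R => inset (push_in z.1 (clamp01 z.2))); split.
- apply: continuous_into_set => /=; apply: continuous_pair; first by continuity.
  apply: normalize_continuous => i.
  have ch : continuous (fun z : W * R => high_vec (unfold z.1) 0 i).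
    by apply: (continuous_after (@high_vec_continuous i)); continuity.
  apply: (continuous_ext (f := fun z : W * R => (1 - clamp z.2) *
    high_vec (unfold z.1) 0 i + clamp z.2 * sval (sval z.1).2 0 i)) => [z|].
    by rewrite !mxE.
  by continuity.
- by [].
- move=> z; apply: inset_inj => /=; rewrite [RHS]surjective_pairing;
    congr (_, _).
  apply: normalize_id.
  by rewrite clamp1 subrr scale0r add0r scale1r.
Qed.

(** A new cone over a sphere of dimension [k - 1] has the effect of a wedge
    with a sphere of dimension [k]: the old complex contains another cone on
    the same base, and shrinking this one to its apex separates the sphere made
    of the two cones from the rest. *)
Lemma unfold_hequiv : hequiv R unfold.
Proof.
split; first exact: unfold_continuous.
by exists fold; split; [exact: fold_continuous|exact: fold_unfold_homotopic
  |exact: unfold_fold_homotopic].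
Qed.

End AttachCone.

(** * Components and isolated points *)

Section Components.
Context {R : realType}.
Implicit Types X Y : topologicalType.

Local Notation joined := (joined R).

Definition locally_constant X (c : X -> nat) : Prop :=
  forall x, \forall y \near x, c y = c x.

Lemma locally_constant_comp X Y (f : Y -> X) (c : X -> nat) :
  continuous f -> locally_constant c -> locally_constant (c \o f).
Proof. by move=> cf lc y; apply: cf (lc (f y)). Qed.

Lemma locally_constant_open X (c : X -> nat) (P : nat -> Prop) :
  locally_constant c -> open [set x | P (c x)].
Proof.
by move=> lc; rewrite openE => x /= Px; apply: filterS (lc x) => y /= ->.
Qed.

Lemma connected_constant X (c : X -> nat) (C : set X) x y :
  locally_constant c -> connected C -> C x -> C y -> c x = c y.
Proof.
move=> lc cC Cx Cy.
have e : C `&` [set z | c z = c x] = C.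
  apply: cC; first by exists x.
    exists [set z | c z = c x] => //.
    exact: (locally_constant_open (fun n => n = c x) lc).
  exists [set z | c z = c x] => //.
  rewrite -openC (_ : ~` _ = [set z | c z <> c x]); last by [].
  exact: (locally_constant_open (fun n => n <> c x) lc).
by move: Cy; rewrite -e => -[_ /= ->].
Qed.

Lemma connected_line : connected [set: R].
Proof. by apply/connected_intervalP => x y _ _ z _. Qed.

Lemma joined_constant X (c : X -> nat) x y :
  locally_constant c -> joined x y -> c x = c y.
Proof.
move=> lc [g [cg <- <-]].
apply: (connected_constant (C := setT) (locally_constant_comp cg lc)) => //.
exact: connected_line.
Qed.

(** The indicator of an isolated point is locally constant. *)
Lemma joined_isolated X (x y : X) : hausdorff_space X -> open [set x] ->
  joined x y -> y = x.
Proof.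
move=> hX ox.
pose c z : nat := if pselect (z = x) then 0%N else 1%N.
have c0 z : c z = 0%N <-> z = x by rewrite /c; case: pselect.
have lc : locally_constant c.
  move=> z; rewrite /c; case: (pselect (z = x)) => /= zx.
    rewrite zx; apply: filterS (open_nbhs_nbhs (conj ox erefl)) => w /= ->.
    by case: pselect.
  have oC : open (~` [set x]).
    by apply: closed_openC; exact:
      (accessible_closed_set1 (hausdorff_accessible hX)).
  apply: filterS (open_nbhs_nbhs (conj oC zx)) => w /= wx.
  by case: pselect.
by move=> /(joined_constant lc) => h; apply/c0; rewrite -h; apply/c0.
Qed.

Lemma isolated_open X (x : X) : isolated [set: X] x <-> open [set x].
Proof.
split=> [[_ [V nV]]|ox]; last first.
  split; first by rewrite inE.
  by exists [set x]; [exact: open_nbhs_nbhs|rewrite setIT].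
by rewrite setIT => e; rewrite openE => y /= ->; rewrite /interior -e.
Qed.

(** Finitely many components, numbered by [c], all of them open and path
    connected. *)
Definition finitely_joined X : Prop :=
  exists (M : nat) (c : X -> nat), [/\ locally_constant c,
    forall x, (c x < M)%N & forall x y, c x = c y -> joined x y].

Lemma finitely_joined_components X : finitely_joined X ->
  finite_set (components X).
Proof.
move=> [M [c [lc cM cj]]].
(* The component with number [i], whichever point it is computed from. *)
pose rep (i : nat) : set X :=
  [set y | exists2 x, c x = i & connected_component setT x y].
apply: (@sub_finite_set _ _ (rep @` `I_M)); last first.
  by apply: finite_image; exact: finite_II.
move=> _ [x _ <-]; exists (c x) => /=; first exact: cM.
rewrite eqEsubset; split=> [y [z zx zy]|y xy]; last by exists x.
have [g [cg g0 g1]] := cj _ _ (esym zx).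
apply: connected_component_trans zy.
exists (range g); last by exists 1.
split=> //; first by exists 0.
apply: connected_continuous_connected; first exact: connected_line.
exact: continuous_subspaceT.
Qed.

Lemma finitely_joined_component X (x y : X) : finitely_joined X ->
  connected_component setT x y -> joined x y.
Proof.
move=> [M [c [lc cM cj]]] [C [Cx _ cC] Cy]; apply: cj.
exact: connected_constant cC Cx Cy.
Qed.

(** The component of a nonisolated point is not an isolated point, hence it is
    not among the [m - 1] components that are; only one component is left. *)
Lemma not_isolated_joined X : finitely_joined X ->
  all_components_but_one_isolated_points X ->
  forall x y : X, ~ open [set x] -> ~ open [set y] -> joined x y.
Proof.
move=> fX hX x y ox oy; apply: finitely_joined_component => //.
have fC := finitely_joined_components fX.
have [m mE] := (finite_setP _).1 fC.
have [D [Dsub Dcard Diso]] := hX m mE.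
have cmem z : components X (connected_component setT z) by exists z.
have notD z : ~ open [set z] -> ~ D (connected_component setT z).
  move=> oz /Diso [w /isolated_open ow e]; apply: oz.
  suff -> : z = w by [].
  have : connected_component setT z z by exact: connected_component_refl.
  by rewrite e.
suff -> : connected_component setT x = connected_component setT y.
  exact: connected_component_refl.
apply: contrapT => AB.
have fD : finite_set D by exact: sub_finite_set fC.
have cD := card_fset_set Dcard; have cC := card_fset_set mE.
pose A := connected_component [set: X] x;
  pose B := connected_component [set: X] y.
pose FC := fset_set (components X).
have AC : A \in FC by rewrite in_fset_set // inE; exact: cmem.
have sub : (fset_set D `<=` FC `\ A)%fset.
  apply/fsubsetP => Z; rewrite in_fset_set // inE => DZ; rewrite !inE.
  apply/andP; split; last by rewrite in_fset_set // inE; exact: Dsub.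
  by apply/eqP => ZA; apply: (notD x) => //; rewrite -/A -ZA.
have le : (#|` (FC `\ A)%fset| <= #|` fset_set D|)%N.
  by rewrite cD -cC (finmap.cardfsD1 A FC) AC add1n.
have /eqP e : fset_set D == (FC `\ A)%fset by rewrite eqEfcard sub.
apply: (notD y) => //.
suff : B \in fset_set D by rewrite in_fset_set // inE.
rewrite e !inE; apply/andP; split; first by apply/eqP => BA; apply: AB.
by rewrite in_fset_set // inE; exact: cmem.
Qed.

End Components.

(** * Independence complexes for wedges of spheres *)

Section Modelled.
Context {R : realType}.
Implicit Types X Y W : topologicalType.

Local Notation joined := (joined R).
Local Notation hequiv := (hequiv R).
Local Notation "'cone_complex' N d" :=
  (realization R (independence_complex (cone_graph N d)))
  (at level 10, N at level 9, d at level 9).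
Local Notation vtx N d t := (@vertex_point R (cone_graph N d) (inr t)).

Lemma wedgeX_hequiv_right X Y Y' (p : X) (q : Y) (f : Y -> Y') (g : Y' -> Y) :
  continuous f -> continuous g -> cancel f g -> cancel g f ->
  exists F : wedgeX p q -> wedgeX p (f q), hequiv F /\
    forall x, F (winl p q x) = winl p (f q) x.
Proof.
move=> cf cg fg gf.
have P (z : wedgeX p q) : wedge_set p (f q) ((sval z).1, f (sval z).2).
  by case: (inset_mem z) => ->; [left|right].
have Q (z : wedgeX p (f q)) : wedge_set p q ((sval z).1, g (sval z).2).
  by case: (inset_mem z) => /= ->; [left|right; exact: fg].
exists (fun z => inset (P z)); split; last by move=> x; exact: inset_inj.
apply: (@hequiv_homeo _ _ _ _ (fun z => inset (Q z))).
- by apply: continuous_into_set => /=; continuity.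
- by apply: continuous_into_set => /=; continuity.
- by move=> z; apply: inset_inj; rewrite /= fg; case: (sval z).
- by move=> z; apply: inset_inj; rewrite /= gf; case: (sval z).
Qed.

Lemma sphere0E (s q : Sphere R 0) : (s = q) \/ sval s = - sval q.
Proof.
have := dot_sphere s; have := dot_sphere q; rewrite /dot !big_ord1 => q1 s1.
have : (sval s 0 0 - sval q 0 0) * (sval s 0 0 + sval q 0 0) = 0.
  by rewrite -subr_sqr !expr2; lra.
move=> /eqP; rewrite mulf_eq0 subr_eq0 addr_eq0 => /orP[/eqP e|/eqP e].
  by left; apply: inset_inj; apply/rowP => i; rewrite ord1.
by right; apply/rowP => i; rewrite ord1 mxE.
Qed.

Lemma sphere0_open (q : Sphere R 0) : open [set q].
Proof.
have c : continuous (fun s : Sphere R 0 => sval s 0 0 * sval q 0 0)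
  by continuity.
have -> : [set q] = (fun s :
  Sphere R 0 => sval s 0 0 * sval q 0 0) @^-1` [set x | 0 < x].
  have q1 : 0 < sval q 0 0 * sval q 0 0.
    by have := dot_sphere q; rewrite /dot big_ord1 => ->.
  rewrite eqEsubset; split=> [s ->//|s /= h].
  have [//|e] := sphere0E s q.
  by move: h; rewrite e mxE mulNr oppr_gt0 ltNge ltW.
by apply: open_comp => [s _|]; [exact: c|exact: open_gt].
Qed.

Lemma sphere_other k (q : Sphere R k) : exists s : Sphere R k, s <> q.
Proof.
have P : unit_sphere R k (- sval q) by apply/sphereE;
  rewrite dotNl dotNr opprK dot_sphere.
exists (inset P) => /(congr1 sval) /= e.
have := dot_sphere q; rewrite -{1}e dotNl => h.
by have := dot_sphere q; lra.
Qed.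

(** The second point of a zero sphere is a component of the wedge by itself. *)
Lemma wedgeX_sphere0_move X (p p' : X) (q : Sphere R 0) :
  exists F : wedgeX p q -> wedgeX p' q, hequiv F /\ forall x, F (winl p q x) =
    winl p' q x.
Proof.
pose f (a b : X) (z : wedgeX a q) : wedgeX b q :=
  if pselect ((sval z).2 = q) then winl b q (sval z).1 else winr b q (sval z).2.
have cf a b : continuous (f a b).
  have csnd : continuous (fun z : wedgeX a q => (sval z).2) by continuity.
  apply: (@pasting _ _ [set z : wedgeX a q | (sval z).2 = q]
     [set z : wedgeX a q | (sval z).2 <> q] _
     (fun z => winl b q (sval z).1) (fun z => winr b q (sval z).2)).
  - by apply: closed_coincidence;
      [exact: hausdorff_sphere|exact: csnd|continuity].
  - rewrite -openC (_ : ~` _ =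
      (fun z : wedgeX a q => (sval z).2) @^-1` [set q]).
      by apply: open_comp => [z _|]; [exact: csnd|exact: sphere0_open].
    by rewrite eqEsubset; split=> z /=; [move/contrapT|move=> ->].
  - by move=> z; exact: EM.
  - by move=> z /= e; rewrite /f; case: pselect.
  - by move=> z /= e; rewrite /f; case: pselect.
  - by apply: (continuous_after (@winl_continuous _ _ b q)); continuity.
  - by apply: (continuous_after (@winr_continuous _ _ b q)); continuity.
have fK a b : cancel (f a b) (f b a).
  move=> z; rewrite {2}/f; case: pselect => /= e; rewrite /f;
    case: pselect => //= _.
    by apply: inset_inj; rewrite /= [RHS]surjective_pairing e.
  apply: inset_inj; rewrite /= [RHS]surjective_pairing.
  by case: (inset_mem z) => // ->.
exists (f p p'); split; first exact:
  (hequiv_homeo (cf p p') (cf p' p) (fK p p') (fK p' p)).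
by move=> x; rewrite /f; case: pselect.
Qed.

(** A sphere attached at a point of the path component of [t0] becomes a new
    cone. For a sphere of dimension zero the attaching point does not matter.
    *)
Lemma attach_cone X (p : X) k (q : Sphere R k) N (T : finType) (d : T -> nat)
    (t0 : T) (e : X -> cone_complex N d) :
  hausdorff_space X -> d t0 = N.+1 -> (k <= N.+1)%N -> hequiv e ->
  (k = 0)%N \/ joined (e p) (vtx N d t0) ->
  exists F : wedgeX p q -> cone_complex N (option_dim d k),
    hequiv F /\ forall x, joined (e x) (vtx N d t0) ->
       joined (F (winl p q x)) (vtx N (option_dim d k) (Some t0)).
Proof.
move=> hX dt0 kN he ep.
have hS := @hausdorff_sphere R k.
have hK := @hausdorff_realization R _ (independence_complex (cone_graph N d)).
have [f [cf ff fq]] := sphere_homogeneous q (@pole R k).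
have [F1 [hF1 F1l]] := @wedgeX_hequiv_right X _ _ p q f f cf cf ff ff.
have qw := sphere_well_pointed (f q).
have [F2 [hF2 F2l]] : exists F : wedgeX p (f q) -> wedgeX (vtx N d t0) (f q),
    hequiv F /\ forall a, joined (F (winl p (f q) a))
      (winl (vtx N d t0) (f q) (e a)).
  case: ep => [k0|]; last exact: wedgeX_hequiv.
  have [G [hG Gl]] := wedgeX_hequiv qw hS hX hK he (@joined_refl R _ (e p)).
  subst k; have [H [hH Hl]] := wedgeX_sphere0_move (e p) (vtx N d t0) (f q).
  exists (H \o G); split; first exact: hequiv_comp.
  move=> a; rewrite -Hl; apply: joined_image (Gl a).
  by case: hH.
move: F1 hF1 F1l F2 hF2 F2l qw; rewrite fq => F1 hF1 F1l F2 hF2 F2l qw.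
have hU := @unfold_hequiv R _ _ _ _ _ dt0 kN.
exists (unfold dt0 kN \o (F2 \o F1)); split.
  by apply: hequiv_comp => //; exact: hequiv_comp.
move=> x jx /=; rewrite F1l.
have cU := @unfold_continuous R N T d k t0 dt0 kN.
apply: (@joined_trans _ _ _
  (unfold dt0 kN (winl (vtx N d t0) (@pole R k) (vtx N d t0)))).
  apply: joined_image => //.
  apply: joined_trans (F2l x) _; apply: joined_image => //.
  exact: winl_continuous.
rewrite (_ : unfold _ _ _ = vtx N (option_dim d k) (Some t0)).
  exact: joined_refl.
apply: bary_inj => v; rewrite /bary /= unfold_winl.
by case: v => [e'|[t|]].
Qed.

(** The induction hypothesis. A point is admissible if all nonisolated points
    are joined to it; spheres of positive dimension are attached at admissible
    points only, and these have to lie in the path component of the first cone.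
    In a discrete space every point is admissible, but the equivalence has to
    take it to [t0]; hence it depends on the point. *)
Definition modelled (N : nat) X : Prop :=
  forall p : X, (forall x : X, ~ open [set x] -> joined x p) ->
  exists (T : finType) (d : T -> nat) (t0 : T) (e : X -> cone_complex N d),
    [/\ d t0 = N.+1, hequiv e & joined (e p) (vtx N d t0)].

Lemma open_winl_inv X Y (p : X) (q : Y) (x : X) :
  open [set winl p q x] -> open [set x].
Proof.
move=> ox; rewrite (_ : [set x] = winl p q @^-1` [set winl p q x]).
  by apply: open_comp => // z _; exact: winl_continuous.
rewrite eqEsubset; split=> z /= => [->//|].
by move=> /(congr1 (fun w => (sval w).1)).
Qed.

Lemma open_winr_inv X Y (p : X) (q : Y) (y : Y) :
  open [set winr p q y] -> open [set y].
Proof.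
move=> oy; rewrite (_ : [set y] = winr p q @^-1` [set winr p q y]).
  by apply: open_comp => // z _; exact: winr_continuous.
rewrite eqEsubset; split=> z /= => [->//|].
by move=> /(congr1 (fun w => (sval w).2)).
Qed.

Lemma joined_winl_inv X Y (p : X) (q : Y) (x x' : X) :
  joined (winl p q x) (winl p q x') -> joined x x'.
Proof.
move=> h; apply: (@joined_image _ _ _ (fun z : wedgeX p q => (sval z).1)
  (winl p q x) (winl p q x') _ h).
by continuity.
Qed.

Lemma joined_winl X Y (p : X) (q : Y) (x x' : X) :
  joined x x' -> joined (winl p q x) (winl p q x').
Proof. by apply: joined_image; exact: winl_continuous. Qed.

Lemma finitely_joined_attach X (p : X) k (q : Sphere R k) :
  finitely_joined (R := R) X -> finitely_joined (R := R) (wedgeX p q).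
Proof.
move=> [M [c [lc cM cj]]].
have cfst : continuous (fun z : wedgeX p q => (sval z).1) by continuity.
have csnd : continuous (fun z : wedgeX p q => (sval z).2) by continuity.
case: k q cfst csnd => [|k] q cfst csnd.
  (* The new point is a component of its own, with the number [M]. *)
  pose c' (z : wedgeX p q) : nat :=
    if pselect ((sval z).2 = q) then c (sval z).1 else M.
  exists M.+1, c'; split.
  - move=> z; have lz := locally_constant_comp cfst lc z.
    have oz : \forall w \near z, (sval w).2 = (sval z).2.
      exact: csnd _ _ (open_nbhs_nbhs (conj (sphere0_open (sval z).2) erefl)).
    near=> w; rewrite /c' (_ : (sval w).2 = (sval z).2); last by near: w.
    by case: pselect => //= _; near: w.
  - by move=> z; rewrite /c'; case: pselect => //= _; exact: leqW.
  - move=> z w; rewrite /c'.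
    case: pselect => /= zq; case: pselect => /= wq e.
    + have zl : z = winl p q (sval z).1.
        by apply: inset_inj; rewrite /= [LHS]surjective_pairing zq.
      have wl' : w = winl p q (sval w).1.
        by apply: inset_inj; rewrite /= [LHS]surjective_pairing wq.
      by rewrite zl wl'; apply: joined_winl; exact: cj.
    + by have := cM (sval z).1; rewrite e ltnn.
    + by have := cM (sval w).1; rewrite -e ltnn.
    + suff -> : z = w by exact: joined_refl.
      have [//|zE] := sphere0E (sval z).2 q.
      have [//|wE] := sphere0E (sval w).2 q.
      apply: inset_inj; rewrite [LHS]surjective_pairing [RHS]surjective_pairing.
      congr (_, _); last by apply: inset_inj; rewrite zE wE.
      by case: (inset_mem z) => // ->; case: (inset_mem w) => // ->.
exists M, (c \o (fun z : wedgeX p q => (sval z).1)); split.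
- exact: locally_constant_comp.
- by move=> z /=.
- have jl (z : wedgeX p q) : joined z (winl p q (sval z).1).
    have [[x ->]|[s ->]] := wedgeXP z; first exact: joined_refl.
    apply: (@joined_trans _ _ _ (winr p q q)); last first.
      rewrite (_ : winr p q q = winl p q p); first exact: joined_refl.
      exact: inset_inj.
    apply: joined_image; first exact: winr_continuous.
    exact: sphere_joined.
  move=> z w /= /cj e; apply: joined_trans (jl z) _.
  apply: joined_trans (joined_sym (jl w)); exact: joined_winl.
Unshelve. all: by end_near. Qed.

(** The sphere makes its base point nonisolated, so every admissible point of
    the wedge is joined to it, and this base point was admissible before. *)
Lemma modelled_attach_pos N X (p : X) k (q : Sphere R k) : hausdorff_space X ->
  (0 < k <= N.+1)%N -> modelled N X -> modelled N (wedgeX p q).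
Proof.
move=> hX /andP[k0 kN] mX p' adm.
have jp : joined (winl p q p) p'.
  apply: adm => op; have oq : open [set q].
    apply: (@open_winr_inv _ _ p q q); rewrite (_ : winr p q q = winl p q p) //.
    exact: inset_inj.
  have [s sq] := sphere_other q; apply: sq.
  apply: joined_isolated oq (sphere_joined q s k0).
  exact: hausdorff_sphere.
have [|T [d [t0 [e [dt0 he je]]]]] := mX p.
  move=> x ox; apply: (@joined_winl_inv _ _ p q).
  apply: joined_trans (joined_sym jp); apply: adm => /open_winl_inv.
  exact: ox.
have [F [hF Fl]] := attach_cone q hX dt0 kN he (or_intror je).
exists (option T), (option_dim d k), (Some t0), F; split=> //.
apply: joined_trans (Fl p je); apply: joined_sym; apply: joined_image => //.
by case: hF.
Qed.

(** An old admissible point was admissible before. The new point is admissible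
    only if the wedge is discrete, and then it can be exchanged with an old
    one. *)
Lemma modelled_attach_zero N X (p : X) (q : Sphere R 0) : hausdorff_space X ->
  modelled N X -> modelled N (wedgeX p q).
Proof.
move=> hX mX p' adm.
have hW : hausdorff_space (wedgeX p q) by apply: hausdorff_wedgeX => //;
  exact: hausdorff_sphere.
have [xq|sq] := pselect ((sval p').2 = q).
  have pE : p' = winl p q (sval p').1.
    by apply: inset_inj; rewrite /= [LHS]surjective_pairing xq.
  have [|T [d [t0 [e [dt0 he je]]]]] := mX (sval p').1.
    move=> x ox; apply: (@joined_winl_inv _ _ p q); rewrite -pE.
    by apply: adm => /open_winl_inv.
  have [F [hF Fl]] := attach_cone (p := p) q hX dt0 (leq0n _) he
    (or_introl erefl).
  exists (option T), (option_dim d 0), (Some t0), F; split=> //.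
  by rewrite pE; exact: Fl.
have op' : open [set p'].
  rewrite (_ : [set p'] = (fun z :
    wedgeX p q => (sval z).2) @^-1` [set (sval p').2]).
    apply: open_comp; last exact: sphere0_open.
    by move=> z _; have : continuous (fun z : wedgeX p q => (sval z).2)
      by continuity.
  rewrite eqEsubset; split=> [z ->//|z /= e].
  apply: inset_inj; rewrite [LHS]surjective_pairing [RHS]surjective_pairing e.
  congr (_, _).
  case: (inset_mem z) => [->|h]; last by case: sq; rewrite -e.
  by case: (inset_mem p').
have disc (z : wedgeX p q) : open [set z].
  apply: contrapT => oz; apply: (oz).
  by have /joined_sym/(joined_isolated hW op') -> := adm z oz.
have [|T [d [t0 [e [dt0 he je]]]]] := mX p.
  by move=> x ox; case: ox; exact: open_winl_inv (disc (winl p q x)).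
have [F [hF Fl]] := attach_cone (p := p) q hX dt0 (leq0n _) he
  (or_introl erefl).
(* The transposition of the old and the new point; all functions on a discrete
   space are continuous. *)
pose sw (z : wedgeX p q) : wedgeX p q :=
  if pselect (z = p') then winl p q p else if pselect
    (z = winl p q p) then p' else z.
have csw : continuous sw.
  by move=> z U /nbhs_singleton Uz;
    apply: filterS (open_nbhs_nbhs (conj (disc z) erefl)) => w /= ->.
have swK : involutive sw.
  move=> z; rewrite {2}/sw; case: pselect => /= [->|zp].
    by rewrite /sw; case: pselect => /= [//|_]; case: pselect.
  case: pselect => /= [->|zl]; first by rewrite /sw; case: pselect.
  by rewrite /sw; case: pselect => //= _; case: pselect.
exists (option T), (option_dim d 0), (Some t0), (F \o sw); split=> //.
  by apply: hequiv_comp => //; exact: (hequiv_homeo csw csw swK swK).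
by rewrite /= {1}/sw; case: pselect => //= _; exact: Fl.
Qed.

Lemma modelled_homeo N X Y : homeomorphic X Y -> modelled N X -> modelled N Y.
Proof.
move=> [f [g [cf cg fg gf]]] mX p adm.
have [|T [d [t0 [e [dt0 he je]]]]] := mX (g p).
  move=> x ox; rewrite -(fg x); apply: joined_image => //; apply: adm => ofx.
  apply: ox; rewrite (_ : [set x] = f @^-1` [set f x]).
    by apply: open_comp => // z _; exact: cf.
  by rewrite eqEsubset; split=> [z ->//|z /= /(can_inj fg)].
exists T, d, t0, (e \o g); split=> //.
by apply: hequiv_comp => //; exact: (hequiv_homeo cg cf gf fg).
Qed.

Lemma finitely_joined_homeo X Y : homeomorphic X Y ->
  finitely_joined (R := R) X -> finitely_joined (R := R) Y.
Proof.
move=> [f [g [cf cg fg gf]]] [M [c [lc cM cj]]].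
exists M, (c \o g); split; first exact: locally_constant_comp.
  by move=> y /=.
by move=> x y /= /cj h; rewrite -(gf x) -(gf y); exact: joined_image.
Qed.

Definition one_point : topologicalType := set_type [set (0 : R)].

Lemma one_pointE (x y : one_point) : x = y.
Proof. by apply: inset_inj; rewrite (inset_mem x) (inset_mem y). Qed.

Lemma one_point_wedgeX Y (p : one_point) (q : Y) : homeomorphic (wedgeX p q) Y.
Proof.
exists (fun z : wedgeX p q => (sval z).2), (winr p q); split.
- by continuity.
- exact: winr_continuous.
- move=> z; apply: inset_inj; rewrite /= [RHS]surjective_pairing.
  congr (_, _); exact: one_pointE.
- by [].
Qed.

(** The single cone on the whole cross-polytope contracts to its apex. *)
Lemma one_point_modelled N : modelled N one_point.
Proof.
move=> p _; pose d (_ : unit) := N.+1.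
exists unit, d, tt; exists (fun=> vtx N d tt); split=> //;
  last exact: joined_refl.
have cclamp := @continuous_clamp R.
have P (z : cone_complex N d * R) : realization_set
    (independence_complex (cone_graph N d))
    (fun v => (1 - clamp z.2) * bary (vtx N d tt) v + clamp z.2 * bary z.1 v).
  have /andP[c0 c1] := clamp01 z.2.
  apply/independence_realizationP; split=> [v||v w vw].
  - by apply: addr_ge0; apply: mulr_ge0; rewrite ?subr_ge0 ?bary_ge0.
  - by rewrite big_split /= -!mulr_sumr (bary_sum (vtx N d tt))
      (bary_sum z.1) !mulr1 subrK.
  - have nb u : @adj (cone_graph N d) (inr tt) u -> False.
      by move=> /(@adj_base N unit d tt erefl)[[]].
    have z0 u : u <> inr tt -> bary (vtx N d tt) u = 0.
      by rewrite /bary /= => /eqP/negbTE ->.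
    rewrite !z0; last 2 first.
    + by move=> e; rewrite e adj_sym in vw; exact: nb vw.
    + by move=> e; rewrite e in vw; exact: nb vw.
    rewrite mulr0 !add0r.
    by have [->|->] := bary_adj z.1 vw; rewrite mulr0; [left|right].
split; first by move=> z; apply: (@continuous_cst one_point _ (vtx N d tt)).
exists (fun=> p); split.
- by move=> z; apply: (@continuous_cst _ one_point p).
- apply: eq_homotopic_line => [|z]; last exact: one_pointE.
  exact: (@continuous_cst one_point one_point p).
- exists (fun z => inset (P z)); split.
  + apply: continuous_into_realization => v.
    apply: (continuous_ext (f := fun z : cone_complex N d * R =>
      (1 - clamp z.2) * bary (vtx N d tt) v + clamp z.2 * bary z.1 v)) => //.
    by continuity_bary.
  + move=> x; apply: bary_inj => v; rewrite {1}/bary /=.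
    by rewrite clamp0 subr0 mul1r mul0r addr0.
  + move=> x; apply: bary_inj => v; rewrite {1}/bary /=.
    by rewrite clamp1 subrr mul0r mul1r add0r.
Qed.

Lemma iterated_wedge_point s Y : iterated_wedge R s Y -> exists y : Y, True.
Proof.
elim=> [k|{}s t X {}Y p q _ _ _ _].
  by exists (inset (@delta_sphere R k 0)).
exists (@wedge_lift _ (fun b : bool => if b then X else Y)
  (fun b : bool => if b return (if b then X else Y) then p else q) true p).
by [].
Qed.

(** Being modelled by cones is preserved by the attachment of one sphere, hence
    it passes from a point to the whole wedge; the hypothesis on the components
    provides an admissible point at the end. *)
Lemma wedge_of_spheres_model s X : wedge_of_spheres R s X ->
  all_components_but_one_isolated_points X ->
  exists (N : nat) (T : finType) (d : T -> nat),
    homotopy_equivalent R (cone_complex N d) X.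
Proof.
move=> [W wW XW] hX.
pose N := \max_(k <- s) k.
have sN : all (fun k => (k <= N.+1)%N) s.
  by apply/allP => k ks; apply: leqW; exact: leq_bigmax_seq.
(* Spheres of dimension at most [N + 1] can be attached, because the largest
   cone is on [N + 1] pairs. *)
pose P Y := [/\ hausdorff_space Y, finitely_joined (R := R) Y & modelled N Y].
have P1 : P one_point.
  split.
  - by move=> x y _; exact: one_pointE.
  - exists 1%N, (fun=> 0%N); split=> //.
    + by move=> x; exact: (filterE (F := nbhs x)).
    + by move=> x y _; rewrite (one_pointE x y); exact: joined_refl.
  - exact: one_point_modelled.
have PH Y Z : homeomorphic Y Z -> P Y -> P Z.
  move=> YZ [hY fY mY]; split.
  - exact: hausdorff_homeo (homeomorphic_sym YZ) hY.
  - exact: finitely_joined_homeo YZ fY.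
  - exact: modelled_homeo YZ mY.
have PA Y (p : Y) k (q : Sphere R k) : (k <= N.+1)%N -> P Y -> P (wedgeX p q).
  move=> kN [hY fY mY]; split.
  - by apply: hausdorff_wedgeX => //; exact: hausdorff_sphere.
  - exact: finitely_joined_attach.
  - case: k q kN => [|k] q kN; first exact: modelled_attach_zero.
    exact: modelled_attach_pos.
have [w _] := iterated_wedge_point wW.
pose o : one_point := inset (erefl : [set (0 : R)] 0).
have PW : P X.
  apply: (PH _ _ (homeomorphic_sym XW)); apply: (PH _ _ (one_point_wedgeX o w)).
  exact: (iterated_wedge_ind_attach PH PA wW sN).
have [hXX fX mX] := PW.
have [p pP] : exists p : X, forall x : X, ~ open [set x] -> joined x p.
  have [[p op]|no] := pselect (exists p : X, ~ open [set p]).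
    by exists p => x ox; exact: not_isolated_joined.
  have [f [g _]] := XW; exists (g w) => x ox; case: no; by exists x.
have [T [d [t0 [e [_ he _]]]]] := mX p pP.
exists N, T, d; have [g hg] := hequiv_inverse he.
exact: hequiv_homotopy_equivalent hg.
Qed.

End Modelled.

(** * Chord diagrams *)

Section PermutationDiagram.
Context {R : realType}.

(** The rational parametrization of the circle: intersections of chords become
    rational identities in the parameters, and parameters of opposite sign lie
    on opposite sides of the axis through the ends of the two arcs. *)
Definition circle_point (t : R) : 'rV[R]_2 :=
  \row_(j < 2) (if j == 0 then (1 - t ^+ 2) / (1 + t ^+ 2)
                else (2 * t) / (1 + t ^+ 2)).

Lemma sqr1_gt0 (t : R) : 0 < 1 + t ^+ 2.
Proof. by rewrite ltr_pwDl // sqr_ge0. Qed.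

Lemma sqr1_neq0 (t : R) : 1 + t ^+ 2 != 0.
Proof. by rewrite gt_eqF // sqr1_gt0. Qed.

Lemma circle_point0 t : circle_point t 0 0 = (1 - t ^+ 2) / (1 + t ^+ 2).
Proof. by rewrite mxE. Qed.

Lemma circle_point1 t : circle_point t 0 1 = (2 * t) / (1 + t ^+ 2).
Proof. by rewrite mxE. Qed.

Lemma row2P (x y : 'rV[R]_2) : x 0 0 = y 0 0 -> x 0 1 = y 0 1 -> x = y.
Proof.
move=> h0 h1; apply/rowP => -[[|[|//]] i].
  by rewrite (_ : Ordinal i = 0) //; apply: val_inj.
by rewrite (_ : Ordinal i = 1) //; apply: val_inj.
Qed.

Lemma circle_point_on t : unit_sphere R 1 (circle_point t).
Proof.
rewrite /unit_sphere /= big_ord_recl big_ord1 (_ : lift ord0 ord0 = 1);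
  last exact: val_inj.
rewrite (_ : ord0 = 0) ?circle_point0 ?circle_point1; last exact: val_inj.
by have := sqr1_neq0 t; move=> ?; field.
Qed.

Lemma circle_point_inj : injective circle_point.
Proof.
move=> s t st.
have := congr1 (fun x : 'rV[R]_2 => x 0 0) st; rewrite !circle_point0 => e0.
have := congr1 (fun x : 'rV[R]_2 => x 0 1) st; rewrite !circle_point1 => e1.
have tan (u : R) : u = (2 * u / (1 + u ^+ 2)) /
  (1 + (1 - u ^+ 2) / (1 + u ^+ 2)).
  have h := sqr1_neq0 u; field.
  by rewrite h /=; apply: lt0r_neq0; lra.
by rewrite (tan s) (tan t) e0 e1.
Qed.

(** The angle of a point of the upper half circle is the inverse cosine of its
    abscissa. *)
Lemma upper_arc (t : R) : 0 < t -> circle_arc 0 pi (circle_point t).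
Proof.
move=> t0; set X := (1 - t ^+ 2) / (1 + t ^+ 2).
have p1 := sqr1_gt0 t; have n1 := sqr1_neq0 t.
have X1 : -1 <= X <= 1.
  by rewrite /X ler_pdivlMr // ler_pdivrMr //; have := sqr_ge0 t; lra.
exists (acos X).
  by rewrite /= in_itv /= acos_ge0 ?acos_lepi.
apply: row2P; rewrite ?circle_point0 ?circle_point1 mxE /=; first
  by rewrite acosK ?in_itv.
rewrite sin_acos //.
have -> : 1 - X ^+ 2 = (2 * t / (1 + t ^+ 2)) ^+ 2 by rewrite /X; field.
by rewrite sqrtr_sqr ger0_norm // divr_ge0 ?ltW // mulr_gt0.
Qed.

(** Mirror image of the upper arc. *)
Lemma lower_arc (t : R) : t < 0 -> circle_arc pi (0 + pi *+ 2) (circle_point t).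
Proof.
move=> t0; have nt0 : 0 < - t by rewrite oppr_gt0.
have [u] := upper_arc nt0.
rewrite /= in_itv /= => /andP[u0 u1] e.
have e0 := congr1 (fun x : 'rV[R]_2 => x 0 0) e.
have e1 := congr1 (fun x : 'rV[R]_2 => x 0 1) e.
rewrite circle_point0 sqrrN mxE /= in e0;
  rewrite circle_point1 sqrrN mxE /= in e1.
exists (pi *+ 2 - u).
  by rewrite /= in_itv /= mulr2n; lra.
apply: row2P; rewrite ?circle_point0 ?circle_point1 mxE /=.
  by rewrite cosB cos2pi sin2pi mul1r mul0r addr0.
rewrite sinB cos2pi sin2pi mul1r mul0r sub0r e1.
by rewrite mulrN mulNr opprK.
Qed.

(** An equation of the line through the points of parameters [a] and [b]. *)
Lemma line_form (a b t : R) :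
  (1 - a * b) * circle_point t 0 0 + (a + b) * circle_point t 0 1 -
    (1 + a * b) =
  - 2 * ((t - a) * (t - b)) / (1 + t ^+ 2).
Proof. by rewrite circle_point0 circle_point1; have h := sqr1_neq0 t;
  field. Qed.

(** Both ends of the outer chord lie strictly on the same side of the line that
    carries the inner one. *)
Lemma nested_disjoint (a b c d : R) (x : 'rV[R]_2) : c < a -> a < b -> b < d ->
  [set (1 - t) *: circle_point a + t *: circle_point b | t in `[0, 1]] x ->
  [set (1 - t) *: circle_point c + t *: circle_point d | t in `[0, 1]] x ->
    False.
Proof.
move=> ca ab bd [s _ <-] [t]; rewrite /= in_itv /= => /andP[t0 t1] e.
have e0 := congr1 (fun x : 'rV[R]_2 => x 0 0) e.
have e1 := congr1 (fun x : 'rV[R]_2 => x 0 1) e.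
rewrite !mxE -/(circle_point _ 0 0) -/(circle_point _ 0 1) in e0 e1.
have fa := line_form a b a; have fb := line_form a b b.
have fc := line_form a b c; have fd := line_form a b d.
rewrite !circle_point0 !circle_point1 in fa fb fc fd.
rewrite subrr mul0r mulr0 mul0r in fa; rewrite subrr mulr0 mulr0 mul0r in fb.
have c0 : - 2 * ((c - a) * (c - b)) / (1 + c ^+ 2) < 0.
  by rewrite ltr_pdivrMr ?sqr1_gt0 // mul0r; nra.
have d0 : - 2 * ((d - a) * (d - b)) / (1 + d ^+ 2) < 0.
  by rewrite ltr_pdivrMr ?sqr1_gt0 // mul0r; nra.
rewrite -fc in c0; rewrite -fd in d0.
move: e0 e1 fa fb c0 d0 => /=.
set A0 := _ / (1 + a ^+ 2); set A1 := _ / (1 + a ^+ 2).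
set B0 := _ / (1 + b ^+ 2); set B1 := _ / (1 + b ^+ 2).
set C0 := _ / (1 + c ^+ 2); set C1 := _ / (1 + c ^+ 2).
set D0 := _ / (1 + d ^+ 2); set D1 := _ / (1 + d ^+ 2).
move=> e0 e1 fa fb c0 d0.
have : (1 - t) * ((1 - a * b) * C0 + (a + b) * C1 - (1 + a * b)) +
       t * ((1 - a * b) * D0 + (a + b) * D1 - (1 + a * b)) = 0.
  have -> : (1 - t) * ((1 - a * b) * C0 + (a + b) * C1 - (1 + a * b)) +
       t * ((1 - a * b) * D0 + (a + b) * D1 - (1 + a * b)) =
     (1 - a * b) * ((1 - t) * C0 + t * D0) + (a + b) *
       ((1 - t) * C1 + t * D1) - (1 + a * b).
    by ring.
  rewrite e0 e1.
  have -> : (1 - a * b) * ((1 - s) * A0 + s * B0) + (a + b) *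
    ((1 - s) * A1 + s * B1) - (1 + a * b) =
     (1 - s) * ((1 - a * b) * A0 + (a + b) * A1 - (1 + a * b)) +
       s * ((1 - a * b) * B0 + (a + b) * B1 - (1 + a * b)) by ring.
  by rewrite fa fb !mulr0 addr0.
move: c0 d0; move: (_ - (1 + a * b)) (_ - (1 + a * b)) => v w v0 w0 vw.
have [tt|tt] := eqVneq t 0; first by move: vw; rewrite tt; lra.
have tp : 0 < t by rewrite lt_def tt.
nra.
Qed.

(** The equation of each chord, evaluated at the ends of the other one, gives
    the weights of the common point. *)
Lemma crossing_meet (a b c d : R) : a < c -> c < b -> b < d ->
  [set (1 - t) *: circle_point a + t *: circle_point b | t in `[0, 1]] `&`
  [set (1 - t) *: circle_point c + t *: circle_point d | t in `[0, 1]] !=set0.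
Proof.
move=> ac cb bd.
pose wa := (b - c) * (d - b) * (1 + a ^+ 2).
pose wb := (c - a) * (d - a) * (1 + b ^+ 2).
pose wc := (d - a) * (d - b) * (1 + c ^+ 2).
pose wd := (c - a) * (b - c) * (1 + d ^+ 2).
have wa0 : 0 < wa by rewrite /wa !mulr_gt0 ?sqr1_gt0 ?subr_gt0.
have wb0 : 0 < wb by rewrite /wb !mulr_gt0 ?sqr1_gt0 ?subr_gt0 //
  (lt_trans ac) ?(lt_trans cb).
have wc0 : 0 < wc by rewrite /wc !mulr_gt0 ?sqr1_gt0 ?subr_gt0 //
  (lt_trans ac) ?(lt_trans cb).
have wd0 : 0 < wd by rewrite /wd !mulr_gt0 ?sqr1_gt0 ?subr_gt0.
have frac (x y : R) : 0 < x -> 0 < y -> `[0, 1]%classic (y / (x + y)).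
  move=> x0 y0; rewrite /= in_itv /= divr_ge0 ?ler_pdivrMr ?mul1r
    ?addr_gt0 //; lra.
exists ((1 - wb / (wa + wb)) *: circle_point a +
  (wb / (wa + wb)) *: circle_point b).
split; first by exists (wb / (wa + wb)) => //; exact: frac.
exists (wd / (wc + wd)); first exact: frac.
have ha := sqr1_neq0 a; have hb := sqr1_neq0 b; have hc := sqr1_neq0 c;
  have hd := sqr1_neq0 d.
have hab : wa + wb != 0 by rewrite gt_eqF ?addr_gt0.
have hcd : wc + wd != 0 by rewrite gt_eqF ?addr_gt0.
rewrite /wa /wb /wc /wd in hab hcd *.
apply: row2P; rewrite !mxE /=; field; by rewrite ha hb hc hd hab hcd.
Qed.

(** The two ends of a chord have the parameters [p + 1] and [- (b + 1)]. Two
    chords cross if and only if their orders on the two arcs disagree;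
    otherwise they are nested. *)
Lemma permutation_graph_of_positions (G : graph) (p b : G -> nat) :
  injective p -> injective b ->
  (forall u v, adj u v = ((p u < p v) && (b v < b u))%N ||
                         ((p v < p u) && (b u < b v))%N) ->
  permutation_graph R G.
Proof.
move=> pI bI adjE.
pose par (c : G) (e : bool) : R := if e then (p c).+1%:R else - (b c).+1%:R.
have pos n : 0 < n.+1%:R :> R by rewrite ltr0n.
have end_on c e : unit_sphere R 1 (circle_point (par c e))
  by exact: circle_point_on.
have end_inj : injective (fun ce : G * bool => circle_point (par ce.1 ce.2)).
  move=> [c e] [c' e'] /circle_point_inj /=; rewrite /par.
  have ne m n : - m.+1%:R <> n.+1%:R :> R.
    by move=> h; have := pos m; have := pos n; rewrite -h; lra.
  case: e e' => -[].
  - by move=> /eqP; rewrite eqr_nat => /eqP [/pI ->].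
  - by move=> /esym /ne.
  - by move=> /ne.
  - by move=> /eqP; rewrite eqr_opp eqr_nat => /eqP [/bI ->].
exists (ChordDiagram end_on end_inj); split.
  exists 0, pi; split; [exact: pi_gt0|by rewrite add0r mulr2n;
    have := pi_gt0 R; lra|].
  move=> c; exists true; split; first exact: upper_arc.
  by apply: lower_arc; rewrite /par oppr_lt0.
have cross u v : (p u < p v)%N -> (b v < b u)%N ->
    chord (ChordDiagram end_on end_inj) u `&` chord
      (ChordDiagram end_on end_inj) v !=set0.
  move=> puv bvu; apply: crossing_meet; rewrite /par.
  - by rewrite ltrN2 ltr_nat.
  - by have := pos (b v); have := pos (p u); lra.
  - by rewrite ltr_nat.
have nest u v x : (p u < p v)%N -> (b u < b v)%N ->
    chord (ChordDiagram end_on end_inj) u x ->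
      chord (ChordDiagram end_on end_inj) v x -> False.
  move=> puv buv; apply: nested_disjoint; rewrite /par.
  - by rewrite ltrN2 ltr_nat.
  - by have := pos (b u); have := pos (p u); lra.
  - by rewrite ltr_nat.
move=> u v; rewrite adjE; split.
  case/orP => /andP[h1 h2].
    split; last exact: cross.
    by move=> e; rewrite e ltnn in h1.
  split; last by rewrite setIC; exact: cross.
  by move=> e; rewrite e ltnn in h1.
move=> [uv [x [xu xv]]].
have [puv|puv|puv] := ltngtP (p u) (p v); last by case: uv; exact: pI.
- have [buv|buv|buv] := ltngtP (b u) (b v) => //=; last by case: uv; exact: bI.
  by case: (nest u v x puv buv xu xv).
- have [buv|buv|buv] := ltngtP (b u) (b v) => //=; last by case: uv; exact: bI.
  by case: (nest v u x puv buv xv xu).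
Qed.

(** Each pair of opposite vertices is a pair of crossing chords, and these
    pairs follow one another in disjoint blocks. On one side a vertex of [T]
    starts just before the block [d c], on the other side it ends beyond all
    blocks, so that it crosses exactly the blocks from [d c] on. Reversing the
    order on the second side makes the vertices of [T] cross each other. *)
Lemma cone_graph_permutation N (T : finType) (d : T -> nat) :
  permutation_graph R (cone_graph N d).
Proof.
(* A block has [m] places for vertices of [T], two for the pair of opposite
   vertices, and one spare place. [B] exceeds all positions by more than the
   length of the sequence of blocks. *)
pose m := #|T|; pose M := m.+3.
pose D := \max_t d t.
pose r (t : T) : nat := enum_rank t.
have rm t : (r t < m)%N by exact: ltn_ord.
have rI : injective r by move=> s t /ord_inj/enum_rank_inj.
have dD t : (d t <= D)%N by exact: leq_bigmax.
pose B := (M * (D + N.+3))%N.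
pose p (v : cone_graph N d) : nat := match v with
  | inl (j, b) => (M * j + m + b)%N
  | inr t => (M * d t + r t)%N end.
pose q (v : cone_graph N d) : nat := match v with
  | inl (j, b) => (M * j + m + ~~ b)%N
  | inr t => (B - (M * d t + r t))%N end.
have block x y i j : (i < M)%N -> (j < M)%N -> (x < y)%N ->
  (M * x + i < M * y + j)%N.
  move=> iM jM xy; apply: (@leq_trans (M * x.+1)%N); last first.
    by apply: leq_trans (leq_addr _ _); rewrite leq_mul2l xy orbT.
  by rewrite mulnS addnC -addSn leq_add2r.
have mbM (b : bool) : (m + b < M)%N by rewrite /M; case: b; lia.
have rM t : (r t < M)%N by rewrite /M; have := rm t; lia.
have blockI x y i j : (i < M)%N -> (j < M)%N -> (M * x + i = M * y + j)%N ->
  x = y /\ i = j.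
  move=> iM jM e; have [h|h|h] := ltngtP x y.
  - by have := block _ _ _ _ iM jM h; rewrite e ltnn.
  - by have := block _ _ _ _ jM iM h; rewrite e ltnn.
  - by split=> //; move: e; rewrite h => /addnI.
have Bsmall t : (M * d t + r t < M * D.+1)%N.
  by rewrite -[X in (_ < X)%N]addn0; apply: block => //; rewrite ltnS.
have Bbig t j (b : bool) : (j < N.+1)%N ->
  (M * j + m + b < B - (M * d t + r t))%N.
  move=> jN; rewrite ltn_subRL.
  apply: (@leq_trans (M * D.+1 + M * N.+2)%N); last first.
    by rewrite /B -mulnDr leq_mul2l; apply/orP; right; lia.
  rewrite -addnS; apply: leq_add; first exact: ltnW.
  by rewrite -addnA -[X in (_ < X)%N]addn0; apply: block => //; lia.
have Bnot t j (b : bool) : (j < N.+1)%N ->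
    (B - (M * d t + r t) < M * j + m + b)%N = false.
  by move=> jN; apply/negbTE; rewrite -leqNgt ltnW // Bbig.
have cmp t t' : (B - (M * d t' + r t') < B - (M * d t + r t))%N =
    (M * d t + r t < M * d t' + r t')%N.
  have h s : (M * d s + r s < B)%N.
    by apply: leq_trans (Bsmall s) _; rewrite /B leq_mul2l; apply/orP; right;
      lia.
  have := h t; have := h t'; lia.
have pinr t t' : t != t' -> (M * d t + r t)%N != (M * d t' + r t')%N.
  by apply: contra => /eqP /(blockI _ _ _ _ (rM t) (rM t')) [_ /rI ->].
apply: (@permutation_graph_of_positions _ p q).
- move=> [[i a]|t] [[j b]|t'] /=; rewrite -?(addnA (M * _)%N).
  + move=> /(blockI _ _ _ _ (mbM a) (mbM b)) [/ord_inj -> /addnI].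
    by case: a b => -[].
  + move=> /(blockI _ _ _ _ (mbM a) (rM t')) [_ e].
    by have := rm t'; rewrite -e; lia.
  + move=> /(blockI _ _ _ _ (rM t) (mbM b)) [_ e].
    by have := rm t; rewrite e; lia.
  + by move=> /(blockI _ _ _ _ (rM t) (rM t')) [_ /rI ->].
- move=> [[i a]|t] [[j b]|t'] /=.
  + rewrite -!(addnA (M * _)%N) =>
      /(blockI _ _ _ _ (mbM (~~ a)) (mbM (~~ b))) [/ord_inj -> /addnI].
    by case: a b => -[].
  + by move=> e; have := Bbig t' i (~~ a) (ltn_ord i); rewrite e ltnn.
  + by move=> e; have := Bbig t j (~~ b) (ltn_ord j); rewrite -e ltnn.
  + move=> e; have [->//|/pinr] := eqVneq t t'.
    by rewrite neq_ltn -cmp -(cmp t' t) e ltnn.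
- move=> [[i a]|t] [[j b]|t'] /=.
  + rewrite -!(addnA (M * _)%N); have [e|/eqP ij] := eqVneq i j.
      by rewrite e !ltn_add2l; case: a b => -[].
    have sep x y (a' b' : bool) : (x < y)%N ->
        (M * y + (m + a') < M * x + (m + b'))%N = false.
      by move=> xy; apply/negbTE; rewrite -leqNgt ltnW // block.
    have [h|h|h] := ltngtP i j; last by case: ij; exact: ord_inj.
      by rewrite !(sep _ _ _ _ h) andbF.
    by rewrite !(sep _ _ _ _ h) andbF.
  + rewrite Bbig // Bnot // andbF andbT /= -(addnA (M * _)%N).
    case: (leqP (d t') i) => h.
      apply/esym; move: h; rewrite leq_eqVlt => /orP[/eqP <-|h].
        by rewrite ltn_add2l; have := rm t'; lia.
      exact: block.
    by apply/esym/negbTE; rewrite -leqNgt ltnW // block.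
  + rewrite Bbig // Bnot // andbF andbT orbF -(addnA (M * _)%N).
    case: (leqP (d t) j) => h.
      apply/esym; move: h; rewrite leq_eqVlt => /orP[/eqP <-|h].
        by rewrite ltn_add2l; have := rm t; lia.
      exact: block.
    by apply/esym/negbTE; rewrite -leqNgt ltnW // block.
  + rewrite !cmp !andbb; have [->|/[dup] tt /pinr] := eqVneq t t'.
      by rewrite !ltnn.
    by rewrite neq_ltn.
Qed.

End PermutationDiagram.

(** * The theorem *)

Theorem proposition4p3 (R : realType) (n : nat) (k : n.-tuple nat)
    (X : topologicalType) :
  (1 <= n)%N ->
  wedge_of_spheres R k X ->
  all_components_but_one_isolated_points X ->
  exists G : graph,
    permutation_graph R G /\
    homotopy_equivalent R (realization R (independence_complex G)) X.
Proof.
move=> _ wX hX; have [N [T [d eX]]] := wedge_of_spheres_model wX hX.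
by exists (cone_graph N d); split; first exact: cone_graph_permutation.
Qed.
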